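(* Let $\{(u^k,p^k)\}$ be generated by the RPDC method for problem (P) (both as defined in the context), under the assumptions on (P), $K$, $\epsilon$, $\rho$ listed in the context. Let $w^*=(u^*,p^* )$ be a saddle point of the Lagrangian $L$ and let $M$ be a bound of the dual optimal solution of (P), i.e. $\|p^*\|<M$. For any $t>0$ put $\bar u_t=\frac{1}{t+1}\sum_{k=0}^t u^{k+1}$ and $\bar p_t=\frac1{t+1}\sum_{k=0}^t q^k$. Let $\mathbb{E}_{\mathcal{F}_t}$ denote expectation over the random indices $i(0),\dots,i(t)$. Then: (i) (Global estimate of expected bifunction values) for all $u\in\mathbf{U}$, $p\in\mathbb{R}^m$, where $w=(u,p)$ could possibly be random, $$\mathbb{E}_{\mathcal{F}_t}\big[L(\bar u_t,p)-L(u,\bar p_t)\big]\le\frac{N h(w^0,w)}{\epsilon(t+1)},$$ where $h(w,w')=\Lambda(w,w')+\frac{d_3}{d_1}\Lambda(w,w^* )\ge0$, with $\Lambda,d_1,d_3$ as in the context. (ii) (Expected feasibility) $$\mathbb{E}_{\mathcal{F}_t}\|A\bar u_t-b\|\le\frac{N d_5}{(M-\|p^*\|)\,\epsilon\,(t+1)},\qquad d_5=\sup_{\|p\|<M}h(w^0,(u^*,p)).$$ (iii) (Expected suboptimality) $$-\frac{\|p^*\|N d_5}{(M-\|p^*\|)\epsilon(t+1)}\le \mathbb{E}_{\mathcal{F}_t}\big[F(\bar u_t)-F(u^* )\big]\le\frac{N d_5}{\epsilon(t+1)}.$$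
   Context: Problem (P): minimize $F(u)=G(u)+J(u)$ subject to $Au-b=0$, $u\in\mathbf{U}$, where $\mathbf{U}=\mathbf{U}_1\times\cdots\times\mathbf{U}_N\subset\mathbb{R}^n$ is closed and convex, $\mathbf{U}_i\subset\mathbb{R}^{n_i}$, $\sum_i n_i=n$; $A=(A_1,\dots,A_N)\in\mathbb{R}^{m\times n}$ with $A_i\in\mathbb{R}^{m\times n_i}$, $b\in\mathbb{R}^m$; $J(u)=\sum_{i=1}^N J_i(u_i)$ with each $J_i$ a convex, possibly non-smooth function on $\mathbf{U}_i$. Assumptions on (P): $J$ is a convex, lower semi-continuous function (not necessarily differentiable) such that $\mathbf{dom}\,J\cap\mathbf{U}\neq\emptyset$; $G$ is convex and differentiable and its derivative is Lipschitz with constant $B_G$; the Lagrangian $L(u,p)=F(u)+\langle p,Au-b\rangle$ has at least one saddle point, i.e. a point $(u^*,p^* )\in\mathbf{U}\times\mathbb{R}^m$ with $L(u^*,p)\le L(u^*,p^* )\le L(u,p^* )$ for all $u\in\mathbf{U}$, $p\in\mathbb{R}^m$. Core function and parameters: $K$ is strongly convex with parameter $\beta$ and differentiable, with gradient Lipschitz continuous with parameter $B$ on $\mathbf{U}$; $D(u,v)=K(u)-K(v)-\langle\nabla K(v),u-v\rangle$. The parameters $\gamma$, $\epsilon$, $\rho$ satisfy $0<\epsilon<\beta/[B_G+\gamma\lambda_{\max}(A^\top A)]$ and $0<\rho<\frac{2\gamma}{2N-1}$ (so $\gamma>0$), with $\lambda_{\max}(A^\top A)$ the largest eigenvalue of $A^\top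 A$. RPDC method: from an initial point $u^0\in\mathbf{U}$, $p^0\in\mathbb{R}^m$, for $k=0,1,2,\dots$: choose $i(k)$ from $\{1,\dots,N\}$ with equal probability; with $q^k=p^k+\gamma(Au^k-b)$ set $$u^{k+1}=\arg\min_{u\in\mathbf{U}}\ \langle\nabla_{i(k)}G(u^k),u_{i(k)}\rangle+J_{i(k)}(u_{i(k)})+\langle q^k,A_{i(k)}u_{i(k)}\rangle+\tfrac1\epsilon D(u,u^k),\qquad p^{k+1}=p^k+\rho(Au^{k+1}-b),$$ and $w^k=(u^k,p^k)$. For $w=(u,p)$, $w'=(u',p')$ in $\mathbf{U}\times\mathbb{R}^m$ and the saddle point $w^*=(u^*,p^* )$, $$\Lambda(w,w')=D(u',u)+\frac{\epsilon}{2N\rho}\|p-p'\|^2+\frac{\epsilon(N-1)}{N}[L(u,p)-L(u^*,p^* )]+\frac{\epsilon(N-2)\gamma}{2N}\|Au-b\|^2 .$$ Constants: $d_1=\min\big\{\frac1{2N}[N\beta-\epsilon\gamma\lambda_{\max}(A^\top A)],\frac{\epsilon}{4N\gamma}\big\}$, $d_3=\frac{\epsilon(N-1)^2}{2\gamma N(N-2)}$.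
   Formalization: Proved for N>2 and for steps that change only block i(k) (automatic if K is additive over blocks; (i) can fail otherwise). In (i), w is fixed, or u is fixed and p may depend on the draws with E[h(w^0,w)] on the right; u depending on the draws is excluded. *)

(* Defs.v *)
From mathcomp Require Import all_boot all_order all_algebra.
From mathcomp Require Import all_classical all_reals all_analysis.

Set Implicit Arguments.
Unset Strict Implicit.
Unset Printing Implicit Defensive.

Import Order.TTheory GRing.Theory Num.Theory.
Import numFieldNormedType.Exports.

Local Open Scope classical_set_scope.
Local Open Scope ring_scope.

(* The library norm `|x| on 'cV[R]_n is the max norm; the norm meant below is
   the Euclidean one. *)
Definition dot (R : realType) (n : nat) (x y : 'cV[R]_n) : R := (x^T *m y) 0 0.

Definition enorm (R : realType) (n : nat) (x : 'cV[R]_n) : R :=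
  Num.sqrt (dot x x).

Definition grad (R : realType) (n : nat) (f : 'cV[R]_n -> R^o) (x : 'cV[R]_n) :
  'cV[R]_n := \col_j 'd f x (delta_mx j 0).

Definition lipschitz_grad (R : realType) (n : nat) (S : set 'cV[R]_n)
    (f : 'cV[R]_n -> R^o) (k : R) : Prop :=
  forall x y, S x -> S y -> enorm (grad f x - grad f y) <= k * enorm (x - y).

Definition strongly_convex (R : realType) (n : nat) (S : set 'cV[R]_n)
    (f : 'cV[R]_n -> R) (beta : R) : Prop :=
  forall x y (a : R), S x -> S y -> 0 <= a <= 1 ->
    f (a *: x + (1 - a) *: y) <=
    a * f x + (1 - a) * f y - beta / 2 * a * (1 - a) * enorm (x - y) ^+ 2.

(* To be used for functions that never take the value -oo. *)
Definition econvex (R : realType) (n : nat) (f : 'cV[R]_n -> \bar R) : Prop :=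
  forall x y (a : R), 0 < a < 1 ->
    (f (a *: x + (1 - a) *: y)%R <= a%:E * f x + (1 - a)%:E * f y)%E.

Definition lambda_max (R : realType) (n : nat) (S : 'M[R]_n) : R :=
  sup [set a | eigenvalue S a].

(* Data of: minimize G(u) + \sum_i J_i(u_i) subject to A u = b and u_i \in U_i.
   R^n = R^(n_1) x ... x R^(n_N) is 'cV[R]_(\sum_i n_ i); the i-th block of u is
   submxcol u i and the i-th column block of A is submxrow A i.
   The J_i are extended-valued, so that J has an effective domain. *)
Record problem (R : realType) (N m : nat) (n_ : 'I_N -> nat) := Problem {
  pU_ : forall i, set 'cV[R]_(n_ i);
  pG : 'cV[R]_(\sum_i n_ i) -> R^o;
  pJ_ : forall i, 'cV[R]_(n_ i) -> \bar R;
  pA : 'M[R]_(m, \sum_i n_ i);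
  pb : 'cV[R]_m }.

Section Problem.
Context (R : realType) (N m : nat) (n_ : 'I_N -> nat) (P : problem R m n_).
Notation vecU := 'cV[R]_(\sum_i n_ i).
Notation vecP := 'cV[R]_m.

Definition feas_set : set vecU := [set u | forall i, pU_ P (submxcol u i)].

Definition Jsum (u : vecU) : \bar R := (\sum_i pJ_ P (submxcol u i))%E.

Definition objF (u : vecU) : \bar R := ((pG P u)%:E + Jsum u)%E.

Definition resid (u : vecU) : vecP := pA P *m u - pb P.

Definition lagr (u : vecU) (p : vecP) : \bar R :=
  (objF u + (dot p (resid u))%:E)%E.

Definition saddle_point (us : vecU) (ps : vecP) : Prop :=
  feas_set us /\
  forall u p, feas_set u ->
    (lagr us p <= lagr us ps)%E /\ (lagr us ps <= lagr u ps)%E.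

Record problem_assumptions (BG : R) : Prop := {
  U_closed : closed feas_set;
  U_convex : convex_set feas_set;
  J_proper : forall (i : 'I_N) (x : 'cV[R]_(n_ i)), pJ_ P x != -oo%E;
  J_convex : forall i, econvex (pJ_ P (i := i));
  J_lsc : lower_semicontinuous Jsum;
  J_dom : exists2 u, feas_set u & (Jsum u < +oo)%E;
  G_convex : convex_function setT (pG P);
  G_diff : forall u, differentiable (pG P) u;
  BG_ge0 : 0 <= BG;
  G_lip : lipschitz_grad setT (pG P) BG }.

Record core_assumptions (K : vecU -> R^o) (beta B : R) : Prop := {
  beta_gt0 : 0 < beta;
  K_strong : strongly_convex feas_set K beta;
  K_diff : forall u, feas_set u -> differentiable K u;
  B_ge0 : 0 <= B;
  K_lip : lipschitz_grad feas_set K B }.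

(* The second field is eps < beta / (BG + gamma * lambda_max (A^T A)), written
   so that a zero denominator imposes no upper bound on eps. *)
Record param_assumptions (beta BG gamma eps rho : R) : Prop := {
  eps_gt0 : 0 < eps;
  eps_lt : eps * (BG + gamma * lambda_max ((pA P)^T *m pA P)) < beta;
  rho_gt0 : 0 < rho;
  rho_lt : rho < 2 * gamma / (2 * N%:R - 1) }.

Definition bregman (K : vecU -> R^o) (u v : vecU) : R :=
  K u - K v - dot (grad K v) (u - v).

Definition qvec (gamma : R) (u : vecU) (p : vecP) : vecP :=
  p + gamma *: resid u.

Definition rpdc_obj (K : vecU -> R^o) (gamma eps : R) (i : 'I_N)
    (u : vecU) (p : vecP) (v : vecU) : \bar R :=
  ((dot (submxcol (grad (pG P) u) i) (submxcol v i))%:E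
   + pJ_ P (submxcol v i)
   + (dot (qvec gamma u p) (submxrow (pA P) i *m submxcol v i))%:E
   + (eps^-1 * bregman K v u)%:E)%E.

(* A run of the method on all histories of drawn indices: u s and p s are the
   iterates u^k and p^k reached when the indices i(0), ..., i(k-1) drawn so far
   are the entries of s.
   rpdc_block says that a step is a coordinate step, moving only the drawn
   block. It follows from rpdc_min when K is additive over the blocks, but not
   for a general K, for which the O(1/t) estimates can fail without it. *)
Record rpdc (K : vecU -> R^o) (gamma eps rho : R)
    (u : seq 'I_N -> vecU) (p : seq 'I_N -> vecP) : Prop := {
  rpdc_init : feas_set (u [::]);
  rpdc_feas : forall s i, feas_set (u (rcons s i));
  rpdc_min : forall s i v, feas_set v ->
    (rpdc_obj K gamma eps i (u s) (p s) (u (rcons s i)) <=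
     rpdc_obj K gamma eps i (u s) (p s) v)%E;
  rpdc_block : forall s i j, j != i ->
    submxcol (u (rcons s i)) j = submxcol (u s) j;
  rpdc_dual : forall s i, p (rcons s i) = p s + rho *: resid (u (rcons s i)) }.

Definition ubar (u : seq 'I_N -> vecU) (t : nat) (s : seq 'I_N) : vecU :=
  t.+1%:R^-1 *: \sum_(k < t.+1) u (take k.+1 s).

Definition pbar (gamma : R) (u : seq 'I_N -> vecU) (p : seq 'I_N -> vecP)
    (t : nat) (s : seq 'I_N) : vecP :=
  t.+1%:R^-1 *: \sum_(k < t.+1) qvec gamma (u (take k s)) (p (take k s)).

Definition Lambda (K : vecU -> R^o) (gamma eps rho : R) (us : vecU) (ps : vecP)
    (w w' : vecU * vecP) : \bar R :=
  ((bregman K w'.1 w.1)%:E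
   + (eps / (2 * N%:R * rho) * enorm (w.2 - w'.2) ^+ 2)%:E
   + (eps * (N%:R - 1) / N%:R)%:E * (lagr w.1 w.2 - lagr us ps)
   + (eps * (N%:R - 2) * gamma / (2 * N%:R) * enorm (resid w.1) ^+ 2)%:E)%E.

Definition d1 (beta gamma eps : R) : R :=
  Num.min
    ((2 * N%:R)^-1 *
      (N%:R * beta - eps * gamma * lambda_max ((pA P)^T *m pA P)))
    (eps / (4 * N%:R * gamma)).

Definition d3 (gamma eps : R) : R :=
  eps * (N%:R - 1) ^+ 2 / (2 * gamma * N%:R * (N%:R - 2)).

Definition hfun (K : vecU -> R^o) (beta gamma eps rho : R)
    (us : vecU) (ps : vecP) (w w' : vecU * vecP) : \bar R :=
  (Lambda K gamma eps rho us ps w w'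
   + (d3 gamma eps / d1 beta gamma eps)%:E
     * Lambda K gamma eps rho us ps w (us, ps))%E.

Definition d5 (K : vecU -> R^o) (beta gamma eps rho : R)
    (us : vecU) (ps : vecP) (M : R) (w0 : vecU * vecP) : \bar R :=
  ereal_sup [set hfun K beta gamma eps rho us ps w0 (us, p)
            | p in [set p : vecP | enorm p < M]].

End Problem.

(* Expectation over t indices drawn independently and uniformly from 'I_N. *)
Definition expect (R : realType) (N t : nat) (X : t.-tuple 'I_N -> \bar R) :
  \bar R := (((N ^ t)%:R^-1)%:E * \sum_(s : t.-tuple 'I_N) X s)%E.

(* Main.v *)
(* For a drawn block i, the variational inequality of the argmin, the three-point
   identity of the Bregman distance and the descent lemma for G bound
   (eps/N) [L(u^(k+1), y) - L(v, q^k)] + Lambda(w^(k+1), (v, y))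
   by Lambda(w^k, (v, y)) plus an error term whose sum over i is nonpositive.
   Hence, on average over i, Lambda decreases by the gap, and telescoping over the
   draws bounds the expected gap sum by Lambda(w^0, (v, y)) minus the expectation
   of Lambda(w^(t+1), (v, y)).  The latter is at least - d_3 |p^(t+1) - p^*|^2,
   while Lambda(., w^* ) is a supermartingale dominating d_1 |p - p^*|^2; this
   produces h.  Feasibility and suboptimality follow by taking v = u^* and y
   parallel to the residual of the average, resp. y = 0.

   All quantities are real as soon as J(u^0) is finite; otherwise h(w^0, .) = +oo. *)

Require Import Defs.
From mathcomp Require Import all_boot all_order all_algebra.
From mathcomp Require Import all_classical all_reals all_analysis.
From mathcomp Require Import ring lra.
Import Order.TTheory GRing.Theory Num.Theory.
Import numFieldNormedType.Exports.
Local Open Scope classical_set_scope.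
Local Open Scope ring_scope.

Set Implicit Arguments.
Unset Strict Implicit.
Unset Printing Implicit Defensive.

(** * Euclidean inner product, norm and the Cauchy-Schwarz inequality *)

Section Euclidean.
Context {R : realType} {n : nat}.
Implicit Types x y z : 'cV[R]_n.

Lemma dotE x y : dot x y = \sum_j x j 0 * y j 0.
Proof. by rewrite /dot mxE; apply: eq_bigr => j _; rewrite mxE. Qed.

Lemma dotC x y : dot x y = dot y x.
Proof. by rewrite !dotE; apply: eq_bigr => j _; rewrite mulrC. Qed.

Lemma dotDr x y z : dot x (y + z) = dot x y + dot x z.
Proof. by rewrite /dot mulmxDr mxE. Qed.

Lemma dotDl x y z : dot (y + z) x = dot y x + dot z x.
Proof. by rewrite dotC dotDr !(dotC x). Qed.

Lemma dotZr a x y : dot x (a *: y) = a * dot x y.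
Proof. by rewrite /dot -scalemxAr mxE. Qed.

Lemma dotZl a x y : dot (a *: x) y = a * dot x y.
Proof. by rewrite dotC dotZr dotC. Qed.

Lemma dotNr x y : dot x (- y) = - dot x y.
Proof. by rewrite -scaleN1r dotZr mulN1r. Qed.

Lemma dotNl x y : dot (- x) y = - dot x y.
Proof. by rewrite dotC dotNr dotC. Qed.

Lemma dotBr x y z : dot x (y - z) = dot x y - dot x z.
Proof. by rewrite dotDr dotNr. Qed.

Lemma dotBl x y z : dot (y - z) x = dot y x - dot z x.
Proof. by rewrite dotDl dotNl. Qed.

Lemma dot0r x : dot x 0 = 0.
Proof. by rewrite /dot mulmx0 mxE. Qed.

Lemma dot0l x : dot 0 x = 0.
Proof. by rewrite dotC dot0r. Qed.

Lemma dot_sumr (I : finType) x (F : I -> 'cV[R]_n) :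
  dot x (\sum_i F i) = \sum_i dot x (F i).
Proof. exact: (big_morph _ (dotDr x) (dot0r x)). Qed.

Lemma dot_sqrDZ a x y : dot (x + a *: y) (x + a *: y)
  = dot x x + 2 * a * dot x y + a ^+ 2 * dot y y.
Proof. by rewrite !(dotDl, dotDr, dotZl, dotZr) (dotC y x); ring. Qed.

Lemma dot_sqrB x y : dot (x - y) (x - y) = dot x x - 2 * dot x y + dot y y.
Proof. by rewrite !(dotBl, dotBr) (dotC y x); ring. Qed.

Lemma dot_ge0 x : 0 <= dot x x.
Proof. by rewrite dotE sumr_ge0 // => j _; rewrite -expr2 sqr_ge0. Qed.

Lemma dot_eq0 x : (dot x x == 0) = (x == 0).
Proof.
apply/idP/eqP => [|->]; last by rewrite dot0r.
rewrite dotE psumr_eq0 => [/allP h|j _]; last by rewrite -expr2 sqr_ge0.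
apply/colP => j; rewrite mxE; apply/eqP.
by have := h j (mem_index_enum j); rewrite mulf_eq0 orbb.
Qed.

Lemma enorm_ge0 x : 0 <= enorm x.
Proof. exact: sqrtr_ge0. Qed.

Lemma enorm_sqr x : enorm x ^+ 2 = dot x x.
Proof. by rewrite sqr_sqrtr // dot_ge0. Qed.

Lemma enormZ a x : enorm (a *: x) = `|a| * enorm x.
Proof.
by rewrite /enorm dotZl dotZr mulrA -expr2 sqrtrM ?sqr_ge0 // sqrtr_sqr.
Qed.

(** A nonnegative quadratic polynomial has nonpositive discriminant. The coefficients are abstract,
    so that this yields Cauchy-Schwarz both for [dot] and for a semidefinite form. *)
Lemma dot_psd_discr (q00 q01 q11 : R) : 0 <= q11 ->
  (forall a, 0 <= q00 + 2 * a * q01 + a ^+ 2 * q11) -> q01 ^+ 2 <= q00 * q11.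
Proof.
move=> h11 h; have [e0|ne0] := eqVneq q11 0.
  have [->|ne1] := eqVneq q01 0; first by rewrite e0 expr0n mulr0.
  (* With [q11 = 0] the polynomial is affine in [a]; this point gives it the value -1. *)
  have := h (- (q00 + 1) / (2 * q01)); rewrite e0 mulr0 addr0.
  have -> : q00 + 2 * (- (q00 + 1) / (2 * q01)) * q01 = - 1 by field.
  by rewrite lerNr oppr0 ler10.
have p11 : 0 < q11 by rewrite lt_neqAle eq_sym ne0.
(* The minimiser of the quadratic. *)
have := h (- q01 / q11).
have -> : q00 + 2 * (- q01 / q11) * q01 + (- q01 / q11) ^+ 2 * q11
          = q00 - q01 ^+ 2 / q11 by field.
by rewrite subr_ge0 ler_pdivrMr.
Qed.

Lemma dot_cauchy x y : dot x y ^+ 2 <= dot x x * dot y y.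
Proof.
apply: dot_psd_discr => [|a]; first exact: dot_ge0.
have := dot_ge0 (x + a *: y).
by rewrite !(dotDl, dotDr, dotZl, dotZr) (dotC y x) => h; lra.
Qed.

Lemma dot_le_enorm x y : dot x y <= enorm x * enorm y.
Proof.
rewrite (le_trans (ler_norm _)) // -ler_sqr ?nnegrE ?mulr_ge0 ?enorm_ge0 //.
by rewrite exprMn !enorm_sqr real_normK ?num_real // dot_cauchy.
Qed.

End Euclidean.

(** * Adjoints, operator bounds and the largest eigenvalue of a symmetric matrix *)

Lemma dot_mull (R : realType) m n (A : 'M[R]_(m, n)) x y :
  dot (A *m x) y = dot x (A^T *m y).
Proof. by rewrite /dot trmx_mul mulmxA. Qed.

Lemma dot_mulr (R : realType) m n (A : 'M[R]_(m, n)) x y :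
  dot y (A *m x) = dot (A^T *m y) x.
Proof. by rewrite dotC dot_mull dotC. Qed.

(** Cauchy-Schwarz row by row gives the squared Frobenius norm as a bound; the added 1 makes the
    constant positive. *)
Lemma dot_mul_bound (R : realType) m n (A : 'M[R]_(m, n)) :
  exists2 c : R, 0 < c & forall x, dot (A *m x) (A *m x) <= c * dot x x.
Proof.
exists (1 + \sum_i dot (row i A)^T (row i A)^T).
  by rewrite ltr_wpDr // sumr_ge0 // => i _; exact: dot_ge0.
move=> x; rewrite mulrDl mul1r ler_wpDl ?dot_ge0 // mulr_suml dotE.
apply: ler_sum => i _; rewrite -expr2.
have -> : (A *m x) i 0 = dot (row i A)^T x.
  by rewrite dotE mxE; apply: eq_bigr => j _; rewrite !mxE.
exact: dot_cauchy.
Qed.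

Lemma dot_half (R : realType) n (x y : 'cV[R]_n) c :
  dot y y <= c * dot x x -> dot x y <= (c + 1) * dot x x.
Proof.
move=> h; have := dot_ge0 (x - y); have := dot_ge0 y.
by rewrite !(dotBl, dotBr) (dotC y x); have := dot_ge0 x; lra.
Qed.

(* With mu the supremum of the Rayleigh quotients of S, mu - S is positive
   semidefinite; were it invertible it would be coercive, contradicting the
   choice of mu.  Hence mu is an eigenvalue. *)
Lemma rayleigh_le_lambda_max (R : realType) n (S : 'M[R]_n) x :
  S^T = S -> dot x (S *m x) <= lambda_max S * dot x x.
Proof.
move=> Ssym.
have [c c0 hc] := dot_mul_bound S.
have cub y : dot y (S *m y) <= (c + 1) * dot y y.
  exact: dot_half.
pose Q : set R := [set dot y (S *m y) / dot y y | y in [set y | y != 0]].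
have [->|xn0] := eqVneq x 0; first by rewrite dot0l dot0r mulr0.
have dpos y : y != 0 -> 0 < dot y y.
  by move=> yn0; rewrite lt_neqAle dot_ge0 eq_sym dot_eq0 yn0.
have Qsup : has_sup Q.
  split; first by exists (dot x (S *m x) / dot x x), x.
  by exists (c + 1) => _ [y /= /dpos yp <-]; rewrite ler_pdivrMr.
pose mu := sup Q; pose T := mu%:M - S.
have TE y z : dot z (T *m y) = mu * dot z y - dot z (S *m y).
  by rewrite /T mulmxBl mul_scalar_mx dotBr dotZr.
have Smu y : dot y (S *m y) <= mu * dot y y.
  have [->|/[dup] yn0 /dpos yp] := eqVneq y 0.
    by rewrite dot0l dot0r mulr0.
  by rewrite -ler_pdivrMr //; apply: ub_le_sup; [case: Qsup|exists y].
have Tpsd y : 0 <= dot y (T *m y) by rewrite TE subr_ge0.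
have Tsym y z : dot y (T *m z) = dot z (T *m y).
  by rewrite !TE dotC dot_mulr Ssym (dotC z (S *m y)).
have mueig : eigenvalue S mu.
  apply: contrapT => /negP nev.
  have Tunit : T \in unitmx.
    rewrite -row_free_unit -kermx_eq0; apply: contraNT nev.
    rewrite /eigenvalue /eigenspace => h.
    have -> : S - mu%:M = - T by rewrite /T opprB.
    apply: contraNneq h => h.
    rewrite -submx0 -h; apply/sub_kermxP.
    by rewrite mulmxN mulmx_ker oppr0.
  have [c1 c10 hc1] := dot_mul_bound T.
  have [c2 c20 hc2] := dot_mul_bound (invmx T).
  have coer y : dot y y <= c2 * (c1 + 1) * dot y (T *m y).
    have e : dot y y <= c2 * dot (T *m y) (T *m y).
      by rewrite (le_trans _ (hc2 _)) // mulmxA mulVmx // mul1mx.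
    rewrite (le_trans e) // -mulrA ler_pM2l //.
    set z := T *m y.
    (* Cauchy-Schwarz for the form [dot y (T *m z)], applied to [y] and [z = T *m y]. *)
    have h1 : dot z z ^+ 2 <= dot y (T *m y) * dot z (T *m z).
      apply: dot_psd_discr => // a.
      have := Tpsd (y + a *: z).
      rewrite mulmxDr -scalemxAr !(dotDl, dotDr, dotZl, dotZr) (Tsym y z) -/z => h.
      by lra.
    have h2 : dot z (T *m z) <= (c1 + 1) * dot z z.
      exact: dot_half.
    have [->|/dpos zp] := eqVneq z 0.
      by rewrite dot0l; apply: mulr_ge0; [lra|rewrite ?dot0r].
    have := le_trans h1 (ler_wpM2l (Tpsd y) h2).
    by rewrite expr2 mulrA [_ * (c1 + 1)]mulrC ler_pM2r.
  have kp : 0 < c2 * (c1 + 1) by rewrite mulr_gt0 //; lra.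
  (* Coercivity keeps every Rayleigh quotient below the supremum [mu] by a fixed amount. *)
  have : mu <= mu - (c2 * (c1 + 1))^-1.
    apply: ge_sup; first by case: Qsup.
    move=> _ [y /= /dpos yp <-]; rewrite ler_pdivrMr //.
    by rewrite mulrBl lerBrDl -lerBrDr ler_pdivrMl // -TE coer.
  by rewrite lerBrDr gerDl leNgt invr_gt0 kp.
rewrite (le_trans (Smu x)) // ler_wpM2r ?dot_ge0 //.
(* An eigenvalue is the Rayleigh quotient of its eigenvector, so [mu] bounds the spectrum from
   above. Eigenvectors are row vectors here, hence the transposes. *)
apply: ub_le_sup => //; exists mu => a /= /eigenvalueP [v hv vn0].
have vn : v^T != 0 by rewrite -(inj_eq trmx_inj) trmxK trmx0.
have := Smu v^T.
have -> : S *m v^T = a *: v^T by rewrite -Ssym -trmx_mul hv linearZ.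
by rewrite dotZr ler_pM2r ?dpos.
Qed.

Lemma lambda_max_gram_ge (R : realType) m n (A : 'M[R]_(m, n)) x :
  dot (A *m x) (A *m x) <= lambda_max (A^T *m A) * dot x x.
Proof.
rewrite dot_mull mulmxA rayleigh_le_lambda_max //.
by rewrite trmx_mul trmxK.
Qed.

(* For n = 0 there are no eigenvalues and sup of the empty set is 0. *)
Lemma lambda_max_gram_ge0 (R : realType) m n (A : 'M[R]_(m, n)) :
  0 <= lambda_max (A^T *m A).
Proof.
have [h|/forallNP h] := pselect (exists x : 'cV[R]_n, x != 0).
  case: h => x xn0; have := le_trans (dot_ge0 _) (lambda_max_gram_ge A x).
  rewrite pmulr_lge0 // lt_neqAle dot_ge0 eq_sym dot_eq0 xn0 //.
rewrite /lambda_max (_ : [set a | _] = set0) ?sup0 //.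
rewrite -subset0 => a /= /eigenvalueP [v _ vn0].
by apply: (h v^T); rewrite -(inj_eq trmx_inj) trmxK trmx0.
Qed.

(** * Block decomposition of inner products and matrix-vector products *)

Section Blocks.
Context {R : realType} {N : nat} {n_ : 'I_N -> nat}.

Lemma dot_blocks (x y : 'cV[R]_(\sum_i n_ i)) :
  dot x y = \sum_i dot (submxcol x i) (submxcol y i).
Proof.
rewrite /dot -{1}[x]submxcolK -{1}[y]submxcolK tr_mxcol mul_mxrow_mxcol.
by rewrite summxE.
Qed.

Lemma mulmx_blocks m (A : 'M[R]_(m, \sum_i n_ i)) (x : 'cV[R]_(\sum_i n_ i)) :
  A *m x = \sum_i submxrow A i *m submxcol x i.
Proof. by rewrite -{1}[x]submxcolK -{1}[A]submxrowK mul_mxrow_mxcol. Qed.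

End Blocks.

(** * Gradient inequalities, the descent lemma and Jensen's inequality *)

Section Differential.
Context {R : realType} {n : nat}.
Implicit Types (f : 'cV[R]_n -> R^o) (x y z d : 'cV[R]_n) (a b c C e : R).

Lemma grad_dot f x d : differentiable f x -> 'd f x d = dot (grad f x) d.
Proof.
move=> df; rewrite [d in LHS]matrix_sum_delta dotE linear_sum /=.
apply: eq_bigr => j _; rewrite big_ord1 linearZ /= mxE mulrC //.
Qed.

Lemma grad_littleo f x d e : differentiable f x -> 0 < e ->
  exists2 del, 0 < del & forall a, 0 < a < del ->
    `|f (x + a *: d) - f x - a * dot (grad f x) d| <= e * a.
Proof.
move=> df e0; rewrite -grad_dot //.
have /cvgrPdist_le /(_ e e0) := diff_derivable (v := d) df.
rewrite -/('D_d f x) deriveE //.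
move=> /nbhs_ballP [del /= del0 h]; exists del => // a /andP[a0 adel].
have : ball (0 : R) del a by rewrite -ball_normE /= sub0r normrN gtr0_norm.
move=> /h /= /(_ (lt0r_neq0 a0)); rewrite (addrC (a *: d)) => {}h.
rewrite -(ler_pM2r a0) in h; apply: le_trans h.
set D := 'd f x d; set F := f (x + _) - f x; rewrite [in leRHS]distrC.
have -> : F - a * D = (a^-1 *: F - D) * a.
  by rewrite /GRing.scale /=; field; rewrite gt_eqF.
by rewrite normrM (gtr0_norm a0).
Qed.

(** Divide by [a] and let [a] tend to 0 from the right: the term [C * a ^+ 2] disappears in the
    limit. *)
Lemma derivative_ge (g : R -> R) D c C :
  (forall e, 0 < e -> exists2 del, 0 < del &
     forall a, 0 < a < del -> `|g a - a * D| <= e * a) ->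
  (forall a, 0 < a < 1 -> a * c <= g a + C * a ^+ 2) -> c <= D.
Proof.
move=> gD gc; apply/ler_addgt0Pr => e e0.
have e20 : 0 < e / 2 by rewrite divr_gt0.
have [del del0 hdel] := gD _ e20.
have C1 : 0 < `|C| + 1 by rewrite ltr_wpDl.
(* Small enough for the expansion, below 1, and with [C * a <= e / 2]. *)
pose a := Num.min (Num.min (del / 2) (1 / 2)) (e / 2 / (`|C| + 1)).
have a0 : 0 < a by rewrite /a !lt_min !divr_gt0.
have adel : a < del.
  by apply: (@le_lt_trans _ _ (del / 2)); [rewrite /a !ge_min lexx | lra].
have a1 : a < 1.
  by apply: (@le_lt_trans _ _ (1 / 2)); [rewrite /a !ge_min lexx orbT | lra].
have aC : C * a <= e / 2.
  have : a <= e / 2 / (`|C| + 1) by rewrite /a ge_min lexx orbT.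
  rewrite ler_pdivlMr // => h; apply: le_trans h.
  by rewrite mulrC ler_pM2l // (le_trans (ler_norm C)) // lerDl.
have /ler_normlP [_ h1] : `|g a - a * D| <= e / 2 * a by apply: hdel; rewrite a0.
have h2 : a * c <= g a + C * a ^+ 2 by apply: gc; rewrite a0.
rewrite -(ler_pM2l a0) (le_trans h2) //.
have : a * (C * a) <= a * (e / 2) by rewrite ler_pM2l.
by lra.
Qed.

Lemma grad_ge f x d c C : differentiable f x ->
  (forall a, 0 < a < 1 -> a * c <= f (x + a *: d) - f x + C * a ^+ 2) ->
  c <= dot (grad f x) d.
Proof.
move=> df; apply: derivative_ge (fun a => f (x + a *: d) - f x) _ _ _ _.
by move=> e e0; exact: grad_littleo.
Qed.

Lemma grad_le f x d c C : differentiable f x ->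
  (forall a, 0 < a < 1 -> f (x + a *: d) - f x <= a * c + C * a ^+ 2) ->
  dot (grad f x) d <= c.
Proof.
move=> df h; rewrite -lerN2.
apply: (derivative_ge (g := fun a => - (f (x + a *: d) - f x)) (C := C)).
  move=> e e0; have [del del0 hd] := grad_littleo d df e0.
  exists del => // a /hd; rewrite -normrN; congr (`|_| <= _); ring.
by move=> a /h; lra.
Qed.

(** Strong convexity on the segment from [x] to [y] bounds the increment at parameter [a]; its
    factor [1 - a] leaves an error quadratic in [a], which [grad_le] absorbs. *)
Lemma strongly_convex_grad (S : set 'cV[R]_n) f beta x y :
  strongly_convex S f beta -> S x -> S y -> differentiable f x ->
  f x + dot (grad f x) (y - x) + beta / 2 * enorm (y - x) ^+ 2 <= f y.
Proof.
move=> fc Sx Sy df.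
suff : dot (grad f x) (y - x) <= f y - f x - beta / 2 * enorm (y - x) ^+ 2 by lra.
apply: (grad_le (C := beta / 2 * enorm (y - x) ^+ 2)) => // a /andP[a0 a1].
have -> : x + a *: (y - x) = a *: y + (1 - a) *: x.
  by rewrite scalerBr scalerBl scale1r addrCA.
have a01 : 0 <= a <= 1 by rewrite (ltW a0) (ltW a1).
by have := fc y x a Sy Sx a01; lra.
Qed.

Lemma convex_functionW f : convex_function setT f -> strongly_convex setT f 0.
Proof.
move=> fc x y a _ _ a01; rewrite !mul0r subr0.
have := fc (Itv01 (andP a01).1 (andP a01).2) x y (mem_setT x) (mem_setT y).
by [].
Qed.

Lemma convex_grad f x y : convex_function setT f -> differentiable f x ->
  f x + dot (grad f x) (y - x) <= f y.
Proof.
move=> /convex_functionW fc df.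
by have := strongly_convex_grad (x := x) (y := y) fc Logic.I Logic.I df; lra.
Qed.

Lemma convex_step f z b d : convex_function setT f -> differentiable f z ->
  f z <= f (z - b *: d) + b * dot (grad f z) d.
Proof.
move=> fc df; have := convex_grad (z - b *: d) fc df.
by rewrite addrAC subrr add0r dotNr dotZr; lra.
Qed.

Lemma convex_lipschitz_step f k x z d b c : convex_function setT f ->
  differentiable f z -> lipschitz_grad setT f k -> 0 < b ->
  enorm (z - x) = c * enorm d ->
  f z <= f (z - b *: d) + b * (dot (grad f x) d + k * c * enorm d ^+ 2).
Proof.
move=> fc df fl b0 zx; apply: le_trans (convex_step b d fc df) _.
rewrite lerD2l ler_pM2l // -lerBlDl -dotBl.
apply: le_trans (dot_le_enorm _ _) _.
by rewrite expr2 mulrA -(mulrA k c) -zx ler_wpM2r ?enorm_ge0 // fl.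
Qed.

(** Integration along the segment is replaced by an upper Riemann sum: [slope] bounds the increment
    over a piece by the gradient at its right end, and the Lipschitz bound compares that gradient
    with the one at [x]. With mesh [h] the sum exceeds the claim by [q * h / 2]. *)
Lemma convex_lipschitz_descent f k x d :
  convex_function setT f -> (forall z, differentiable f z) -> 0 <= k ->
  lipschitz_grad setT f k ->
  f (x + d) <= f x + dot (grad f x) d + k / 2 * enorm d ^+ 2.
Proof.
move=> fc df k0 fl.
have slope a b : 0 <= a -> 0 < b ->
    f (x + (a + b) *: d) <= f (x + a *: d)
      + b * (dot (grad f x) d + k * (a + b) * enorm d ^+ 2).
  move=> a0 b0.
  have -> : x + a *: d = (x + (a + b) *: d) - b *: d.
    by rewrite scalerDl addrA addrK.
  apply: convex_lipschitz_step => //.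
  by rewrite addrC addKr enormZ ger0_norm // addr_ge0 // ltW.
apply/ler_addgt0Pr => e e0.
set q := k * enorm d ^+ 2.
have q0 : 0 <= q by rewrite mulr_ge0 ?sqr_ge0.
(* Enough pieces for [q * h <= e]. *)
pose n0 := Num.truncn (q / e).
have nq : q / e < n0.+1%:R by exact: truncnS_gt.
pose h : R := n0.+1%:R^-1.
have h0 : 0 < h by rewrite invr_gt0.
have step j : f (x + (j%:R * h) *: d) <= f x + j%:R * h * dot (grad f x) d
    + q / 2 * (j%:R * (j%:R + 1) * h ^+ 2).
  elim: j => [|j IH]; first by rewrite !mul0r scale0r mulr0 !addr0.
  have j0 : 0 <= j%:R * h by rewrite mulr_ge0 // ltW.
  have := slope _ _ j0 h0.
  rewrite (_ : j%:R * h + h = j.+1%:R * h); last by rewrite -natr1; ring.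
  have -> : k * (j.+1%:R * h) * enorm d ^+ 2 = q * (j.+1%:R * h).
    by rewrite /q mulrAC.
  move=> /le_trans; apply; rewrite -natr1; clearbody q; lra.
have := step n0.+1; rewrite divff ?pnatr_eq0 // scale1r mul1r => /le_trans; apply.
have -> : n0.+1%:R * (n0.+1%:R + 1) * h ^+ 2 = 1 + h.
  rewrite /h; have : n0.+1%:R != 0 :> R by rewrite pnatr_eq0.
  by move: (n0.+1%:R : R) => w w0; field.
have qh : q * h <= e.
  by rewrite ler_pdivrMr // mulrC -ler_pdivrMr // ltW.
have -> : k / 2 * enorm d ^+ 2 = q / 2 by rewrite /q mulrAC.
by lra.
Qed.

(** The mean of [t + 2] points is a convex combination, with weight [(t + 1) / (t + 2)], of the mean
    of the first [t + 1] and the last one. Membership in [S] is carried along because [f] is convex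
    only there. *)
Lemma jensen_mean (S : set 'cV[R]_n) (f : 'cV[R]_n -> R) t (x : nat -> 'cV[R]_n) :
  (forall y z a, S y -> S z -> 0 <= a <= 1 -> S (a *: y + (1 - a) *: z)) ->
  strongly_convex S f 0 -> (forall k, (k <= t)%N -> S (x k)) ->
  S (t.+1%:R^-1 *: \sum_(k < t.+1) x k) /\
  f (t.+1%:R^-1 *: \sum_(k < t.+1) x k) <= t.+1%:R^-1 * \sum_(k < t.+1) f (x k).
Proof.
move=> Sc fc; elim: t => [|t IH] xS.
  by rewrite !big_ord1 invr1 scale1r mul1r; split => //; exact: xS.
have [|IS IF] := IH; first by move=> k kt; apply: xS; exact: leqW.
set y := _ *: _ in IS IF.
pose a : R := t.+1%:R / t.+2%:R.
have t20 : t.+2%:R != 0 :> R by rewrite pnatr_eq0.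
have a01 : 0 <= a <= 1 by rewrite divr_ge0 // ler_pdivrMr // mul1r ler_nat leqnSn.
have a1 : 1 - a = t.+2%:R^-1.
  by rewrite -{1}(divff t20) -mulrBl -[t.+2%:R]natr1 addrAC subrr add0r mul1r natr1.
have aE : a * t.+1%:R^-1 = t.+2%:R^-1.
  by rewrite /a [LHS]mulrAC mulfV ?mul1r // pnatr_eq0.
have -> : t.+2%:R^-1 *: \sum_(k < t.+2) x k = a *: y + (1 - a) *: x t.+1.
  rewrite big_ord_recr /= scalerDr a1; congr (_ + _).
  by rewrite /y scalerA aE.
have Sx : S (x t.+1) by exact: xS.
split; first exact: Sc.
rewrite (le_trans (fc _ _ _ IS Sx a01)) // !mul0r subr0 big_ord_recr /= mulrDr.
rewrite a1 lerD2r (le_trans (ler_wpM2l (andP a01).1 IF)) //.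
by rewrite mulrA aE.
Qed.

End Differential.

Lemma submxcolZ (R : realType) N (n_ : 'I_N -> nat) a
    (x : 'cV[R]_(\sum_i n_ i)) i :
  submxcol (a *: x) i = a *: submxcol x i.
Proof. by apply/matrixP => k l; rewrite !mxE. Qed.

(** * The real-valued Lagrangian on the effective domain, and saddle points *)

Section FiniteLagrangian.
Context {R : realType} {N m : nat} {n_ : 'I_N -> nat} (P : problem R m n_).
Notation vecU := 'cV[R]_(\sum_i n_ i).
Notation vecP := 'cV[R]_m.
Implicit Types (u v : vecU) (p q y : vecP).

(** The effective domain of [Jsum], described block by block; on it the Lagrangian is real. *)
Definition domJ : set vecU := [set u | forall i, pJ_ P (submxcol u i) \is a fin_num].

Definition Fr u : R := pG P u + \sum_i fine (pJ_ P (submxcol u i)).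

Definition Lr u p : R := Fr u + dot p (resid P u).

Lemma objF_fin u : domJ u -> objF P u = (Fr u)%:E.
Proof. by move=> du; rewrite /objF /Jsum -EFin_sum_fine. Qed.

Lemma lagr_fin u p : domJ u -> lagr P u p = (Lr u p)%:E.
Proof. by move=> du; rewrite /lagr objF_fin. Qed.

Lemma residB u v : resid P u - resid P v = pA P *m (u - v).
Proof. by rewrite /resid opprB addrA subrK mulmxBr. Qed.

Lemma resid_mean t (x : nat -> vecU) :
  resid P (t.+1%:R^-1 *: \sum_(k < t.+1) x k)
  = t.+1%:R^-1 *: \sum_(k < t.+1) resid P (x k).
Proof.
rewrite /resid -scalemxAr mulmx_sumr sumrB sumr_const card_ord scalerBr.
by rewrite -(scaler_nat _ (pb P)) scalerA mulVf ?pnatr_eq0 // scale1r.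
Qed.

Section Assumptions.
Context {BG : R} (PA : problem_assumptions P BG).

Lemma J_fin i (x : 'cV[R]_(n_ i)) : (pJ_ P x < +oo)%E -> pJ_ P x \is a fin_num.
Proof. by move=> h; rewrite fin_numE (J_proper PA) lt_eqF. Qed.

Lemma domJP u : domJ u <-> (Jsum P u < +oo)%E.
Proof.
split=> [du|]; first by rewrite /Jsum -EFin_sum_fine // ltry.
rewrite ltey esum_eqy => [|i _]; last exact: J_proper PA _ _.
rewrite negb_exists => /forallP h i; apply: J_fin.
by rewrite ltey; exact: h.
Qed.

Lemma domJPn u : ~ domJ u -> Jsum P u = +oo%E.
Proof.
by move=> h; apply/eqP; rewrite -leye_eq leNgt; apply/negP => /domJP.
Qed.

Lemma lagr_infty u p : ~ domJ u -> lagr P u p = +oo%E.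
Proof. by move=> /domJPn h; rewrite /lagr /objF h. Qed.

Lemma J_convexr i (x y : 'cV[R]_(n_ i)) a :
  pJ_ P x \is a fin_num -> pJ_ P y \is a fin_num -> 0 <= a <= 1 ->
  pJ_ P (a *: x + (1 - a) *: y) \is a fin_num /\
  fine (pJ_ P (a *: x + (1 - a) *: y))
    <= a * fine (pJ_ P x) + (1 - a) * fine (pJ_ P y).
Proof.
move=> xf yf /andP[a0 a1].
(* [econvex] speaks of [0 < a < 1]; the end points are treated apart, avoiding products of 0 with
   infinity. *)
have [->|an0] := eqVneq a 0.
  by rewrite scale0r add0r subr0 scale1r mul0r add0r mul1r.
have [->|an1] := eqVneq a 1.
  by rewrite subrr scale0r addr0 scale1r mul0r addr0 mul1r.
have a01 : 0 < a < 1 by rewrite !lt_neqAle a0 a1 eq_sym an0 an1.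
have := J_convex PA x y a01.
rewrite -[pJ_ P x](fineK xf) -[pJ_ P y](fineK yf) -!EFinM -EFinD /= => h.
have zf : pJ_ P (a *: x + (1 - a) *: y) \is a fin_num.
  by apply: J_fin; rewrite (le_lt_trans h) // ltry.
by split; rewrite // -lee_fin fineK.
Qed.

Lemma feas_convex u v a : feas_set P u -> feas_set P v -> 0 <= a <= 1 ->
  feas_set P (a *: u + (1 - a) *: v).
Proof.
move=> fu fv a01.
have := U_convex PA (Itv01 (andP a01).1 (andP a01).2) (mem_set fu) (mem_set fv).
by move/set_mem.
Qed.

Lemma domJ_convex u v a : domJ u -> domJ v -> 0 <= a <= 1 ->
  domJ (a *: u + (1 - a) *: v).
Proof.
move=> du dv a01 i; rewrite submxcolD !submxcolZ.
by have [] := J_convexr (du i) (dv i) a01.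
Qed.

Lemma Fr_convex : strongly_convex domJ Fr 0.
Proof.
move=> u v a du dv a01; rewrite !mul0r subr0 /Fr.
have := convex_functionW (G_convex PA) (x := u) (y := v) Logic.I Logic.I a01.
rewrite !mul0r subr0.
suff : \sum_i fine (pJ_ P (submxcol (a *: u + (1 - a) *: v) i)) <=
    a * \sum_i fine (pJ_ P (submxcol u i))
    + (1 - a) * \sum_i fine (pJ_ P (submxcol v i)) by lra.
rewrite !mulr_sumr -big_split; apply: ler_sum => i _ /=.
rewrite submxcolD !submxcolZ.
by have [] := J_convexr (du i) (dv i) a01.
Qed.

Context {us : vecU} {ps : vecP} (saddle : saddle_point P us ps).

(** Otherwise the Lagrangian at the saddle point is infinite, yet it is at most its value at a
    feasible point with finite J. *)
Lemma saddle_domJ : domJ us.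
Proof.
have [v fv Jv] := J_dom PA; have /domJP dv := Jv.
apply: contrapT => dus.
have := (saddle.2 v ps fv).2.
by rewrite (lagr_infty ps dus) lagr_fin.
Qed.

(** Moving the multiplier from [ps] by the residual itself raises the Lagrangian by the squared norm
    of the residual, which maximality in the dual variable forbids. *)
Lemma saddle_resid : resid P us = 0.
Proof.
have dus := saddle_domJ.
have := (saddle.2 us (ps + resid P us) saddle.1).1.
rewrite !lagr_fin // lee_fin /Lr dotDl => h.
by apply/eqP; rewrite -dot_eq0 eq_le dot_ge0 andbT; lra.
Qed.

Lemma saddle_Lr p : Lr us p = Fr us.
Proof. by rewrite /Lr saddle_resid dot0r addr0. Qed.

Lemma saddle_le u : feas_set P u -> domJ u -> Fr us <= Lr u ps.
Proof.
move=> fu du; have := (saddle.2 u ps fu).2.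
by rewrite !lagr_fin ?lee_fin ?saddle_Lr //; exact: saddle_domJ.
Qed.

End Assumptions.
End FiniteLagrangian.

(* The slack is the sum of those of the hypotheses, the last three weighted by
   [e * g / 2], [dd / 2] and [e / Nn * r'r' / 2]. *)
Lemma rpdc_step_real (R : realFieldType) (Nn e g r b bg lam : R)
    (F' F pr' pr rr rr' r'r' py yr' V L0 Dv Dv' D dd Y : R) :
  0 < Nn -> 0 < e -> 0 < r -> 0 <= g -> 0 <= dd -> 0 <= r'r' ->
  e * (F' + (pr' + g * rr') - (F + (pr + g * rr))) + e * Y
    <= Dv - Dv' - D + e * bg / 2 * dd ->
  b / 2 * dd <= D ->
  r'r' - 2 * rr' + rr <= lam * dd ->
  e * (bg + g * lam) <= b ->
  r * (2 * Nn - 1) <= 2 * g ->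
  e / Nn * (F' + yr' - V)
  + (Dv' + e / (2 * Nn * r) * (py + 2 * r * (pr' - yr') + r ^+ 2 * r'r')
     + e * (Nn - 1) / Nn * (F' + (pr' + r * r'r') - L0)
     + e * (Nn - 2) * g / (2 * Nn) * r'r')
  <= Dv + e / (2 * Nn * r) * py + e * (Nn - 1) / Nn * (F + pr - L0)
     + e * (Nn - 2) * g / (2 * Nn) * rr
     + e * ((F + (pr + g * rr) - V) / Nn - Y).
Proof.
move=> N0 e0 r0 g0 dd0 s0 h1 h2 h3 h4 h5; rewrite -subr_ge0.
rewrite (_ : _ - _ =
  (Dv - Dv' - D + e * bg / 2 * dd
   - (e * (F' + (pr' + g * rr') - (F + (pr + g * rr))) + e * Y))
  + (D - b / 2 * dd)
  + e * g / 2 * (lam * dd - (r'r' - 2 * rr' + rr))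
  + dd / 2 * (b - e * (bg + g * lam))
  + e / Nn * r'r' / 2 * (2 * g - r * (2 * Nn - 1))); last first.
  by field; rewrite !gt_eqF.
have eg : 0 <= e * g / 2 by rewrite divr_ge0 // mulr_ge0 // ltW.
have er : 0 <= e / Nn * r'r' / 2.
  by rewrite divr_ge0 // mulr_ge0 // divr_ge0 // ltW.
apply: addr_ge0; last by apply: mulr_ge0 => //; rewrite subr_ge0.
apply: addr_ge0.
  apply: addr_ge0; last by apply: mulr_ge0 => //; rewrite subr_ge0.
  by apply: addr_ge0; rewrite subr_ge0.
by apply: mulr_ge0; [rewrite divr_ge0 | rewrite subr_ge0].
Qed.

(** * One step of the method: from the argmin to the averaged decrease of Lambda *)

Section OneStep.
Context {R : realType} {N m : nat} {n_ : 'I_N -> nat} {P : problem R m n_}.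
Context {K : 'cV[R]_(\sum_i n_ i) -> R^o} {BG beta B gamma eps rho : R}.
Notation vecU := 'cV[R]_(\sum_i n_ i).
Notation vecP := 'cV[R]_m.
Implicit Types (u v : vecU) (p q y : vecP) (i : 'I_N).
Hypotheses (PA : problem_assumptions P BG) (CA : core_assumptions P K beta B)
  (QA : param_assumptions P beta BG gamma eps rho) (N2 : (2 < N)%N).

Definition rlin i u p v : R :=
  dot (submxcol (grad (pG P) u) i) (submxcol v i)
  + dot (qvec P gamma u p) (submxrow (pA P) i *m submxcol v i).

Lemma rlinD i u p v w : rlin i u p (v + w) = rlin i u p v + rlin i u p w.
Proof. by rewrite /rlin submxcolD mulmxDr !dotDr; ring. Qed.

Lemma rlinZ i u p a v : rlin i u p (a *: v) = a * rlin i u p v.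
Proof. by rewrite /rlin submxcolZ -scalemxAr !dotZr; ring. Qed.

Lemma rlinB i u p v w : rlin i u p (v - w) = rlin i u p v - rlin i u p w.
Proof. by rewrite rlinD -scaleN1r rlinZ mulN1r. Qed.

Lemma rlin_sum u p v : \sum_i rlin i u p v
  = dot (grad (pG P) u) v + dot (qvec P gamma u p) (pA P *m v).
Proof. by rewrite big_split /= -dot_blocks -dot_sumr -mulmx_blocks. Qed.

(** A move confined to block [i] sees the full gradient and the full matrix; this is where the
    coordinate nature of a step enters. *)
Lemma rlin_block i u p v : (forall j, j != i -> submxcol v j = 0) ->
  rlin i u p v = dot (grad (pG P) u) v + dot (qvec P gamma u p) (pA P *m v).
Proof.
move=> v0; rewrite -rlin_sum (bigD1 i) //= big1 ?addr0 // => j ji.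
by rewrite /rlin v0 // mulmx0 !dot0r addr0.
Qed.

Lemma rpdc_objE i u p v :
  rpdc_obj P K gamma eps i u p v =
  (pJ_ P (submxcol v i) + (rlin i u p v + eps^-1 * bregman K v u)%:E)%E.
Proof.
rewrite /rpdc_obj /rlin (addeC (dot _ _)%:E) -!addeA -!EFinD.
by rewrite addrA.
Qed.

Lemma bregman_three_points u u' v :
  dot (grad K u' - grad K u) (v - u')
  = bregman K v u - bregman K v u' - bregman K u' u.
Proof.
have -> : v - u' = (v - u) - (u' - u) by rewrite opprB addrA subrK.
rewrite /bregman; move: (grad K u') (grad K u) => a b.
by rewrite !(dotBl, dotBr); ring.
Qed.

Lemma bregman_ge u v : feas_set P u -> feas_set P v ->
  beta / 2 * dot (v - u) (v - u) <= bregman K v u.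
Proof.
move=> fu fv.
have := strongly_convex_grad (K_strong CA) fu fv (K_diff CA fu).
by rewrite enorm_sqr /bregman; lra.
Qed.

Lemma natN_gt2 : 2 < N%:R :> R.
Proof. by rewrite ltr_nat. Qed.

Lemma rho_mul_lt : rho * (2 * N%:R - 1) < 2 * gamma.
Proof.
have N3 := natN_gt2.
by rewrite -ltr_pdivlMr; [exact: rho_lt QA | lra].
Qed.

Lemma gamma_gt0 : 0 < gamma.
Proof.
have N3 := natN_gt2; have := rho_mul_lt.
have : 0 < rho * (2 * N%:R - 1) by rewrite mulr_gt0 ?(rho_gt0 QA) //; lra.
by lra.
Qed.

(** Real form of [Lambda] with the arguments exchanged: the reference point [(v, y)] comes before
    the iterate [(u, p)]. *)
Definition Lam us ps v y u p : R :=
  bregman K v u + eps / (2 * N%:R * rho) * enorm (p - y) ^+ 2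
  + eps * (N%:R - 1) / N%:R * (Lr P u p - Lr P us ps)
  + eps * (N%:R - 2) * gamma / (2 * N%:R) * enorm (resid P u) ^+ 2.

Section Argmin.
Context {i : 'I_N} {u u' : vecU} {p : vecP}.
Hypotheses (fu : feas_set P u) (fu' : feas_set P u')
  (u'min : forall v, feas_set P v ->
    (rpdc_obj P K gamma eps i u p u' <= rpdc_obj P K gamma eps i u p v)%E).

Lemma argmin_J_fin : pJ_ P (submxcol u' i) \is a fin_num.
Proof.
have [v fv /(domJP PA) dv] := J_dom PA; apply: (J_fin PA).
have := u'min fv; rewrite !rpdc_objE -(fineK (dv i)).
by case: (pJ_ P (submxcol u' i)) => [r| |] // _; rewrite ltry.
Qed.

(** First-order optimality of [u'] towards [v]: J enters through convexity and only the core
    function is differentiated. The three-point identity then turns the gradient difference into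
    Bregman distances. *)
Lemma argmin_VI v : feas_set P v -> pJ_ P (submxcol v i) \is a fin_num ->
  eps * (rlin i u p (u' - v)
         + fine (pJ_ P (submxcol u' i)) - fine (pJ_ P (submxcol v i)))
  <= bregman K v u - bregman K v u' - bregman K u' u.
Proof.
move=> fv Jv; have Ju' := argmin_J_fin; have e0 := eps_gt0 QA.
rewrite -bregman_three_points.
rewrite rlinB.
suff : dot (grad K u) (v - u') + eps * (rlin i u p u' - rlin i u p v
    + fine (pJ_ P (submxcol u' i)) - fine (pJ_ P (submxcol v i)))
    <= dot (grad K u') (v - u').
  move: (grad K u') (grad K u) (rlin i u p u') (rlin i u p v) => a b c d.
  by rewrite dotBl; lra.
(* Minimality of [u'] along the segment to [v] bounds the one-sided slope of [K] at [u'] from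
   below. *)
apply: (grad_ge (C := 0)); first exact: K_diff CA _ fu'.
move=> a /andP[a0 a1]; rewrite mul0r addr0.
have a01 : 0 <= a <= 1 by rewrite (ltW a0) (ltW a1).
have zE : u' + a *: (v - u') = a *: v + (1 - a) *: u'.
  by rewrite scalerBr scalerBl scale1r addrCA.
have := u'min (feas_convex PA fv fu' a01); rewrite !rpdc_objE -zE.
have [] := J_convexr PA Jv Ju' a01.
rewrite -!submxcolZ -submxcolD -zE => Jz Jc.
rewrite -(fineK Jz) -(fineK Ju') -!EFinD lee_fin [fine (_%:E)]/=.
rewrite (rlinD _ _ _ u') rlinZ rlinB /bregman.
move: (grad K u) (rlin i u p u') (rlin i u p v) => b c d h.
rewrite (_ : u' + a *: (v - u') - u = (u' - u) + a *: (v - u')) in h; last first.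
  by rewrite addrAC.
rewrite (dotDr b (u' - u)) dotZr -(ler_pM2l e0) !mulrDr !(mulrA eps eps^-1) in h.
rewrite divff ?gt_eqF // !mul1r in h.
move: (dot b (v - u')) (dot b (u' - u)) (K u') (K u) (K _) h => x y z k k'.
have {Jc} := ler_wpM2l (ltW e0) Jc.
move: (fine _) (fine _) (fine _) => j j' j'' h; lra.
Qed.

Hypothesis u'block : forall j, j != i -> submxcol u' j = submxcol u j.

Lemma argmin_domJ : domJ P u -> domJ P u'.
Proof.
move=> du j; have [->|ji] := eqVneq j i; first exact: argmin_J_fin.
by rewrite u'block.
Qed.

(** Split [u' - v] into the step [u' - u], which moves block [i] alone and so is controlled by the
    descent lemma for G, and [u - v], which is kept until the average over [i]. *)
Lemma coordinate_descent v : domJ P u -> feas_set P v -> domJ P v ->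
  eps * (Lr P u' (qvec P gamma u p) - Lr P u (qvec P gamma u p))
  + eps * (rlin i u p (u - v)
           + fine (pJ_ P (submxcol u i)) - fine (pJ_ P (submxcol v i)))
  <= bregman K v u - bregman K v u' - bregman K u' u
     + eps * BG / 2 * dot (u' - u) (u' - u).
Proof.
move=> du fv dv; have du' := argmin_domJ du.
have := argmin_VI fv (dv i).
have e0 := eps_gt0 QA.
have := convex_lipschitz_descent u (u' - u) (G_convex PA) (G_diff PA)
  (BG_ge0 PA) (G_lip PA).
rewrite addrC subrK enorm_sqr.
have -> : u' - v = (u' - u) + (u - v) by rewrite addrA subrK.
have rb : rlin i u p (u' - u) = dot (grad (pG P) u) (u' - u)
    + dot (qvec P gamma u p) (pA P *m (u' - u)).
  by apply: rlin_block => j ji; rewrite submxcolB u'block // subrr.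
rewrite rlinD rb => hG hVI.
have hJ : \sum_j fine (pJ_ P (submxcol u' j)) - \sum_j fine (pJ_ P (submxcol u j))
    = fine (pJ_ P (submxcol u' i)) - fine (pJ_ P (submxcol u i)).
  rewrite -sumrB (bigD1 i) //= big1 ?addr0 // => j ji.
  by rewrite u'block // subrr.
rewrite -residB (dotBr (qvec P gamma u p)) in hVI; rewrite /Lr /Fr.
rewrite -(ler_pM2l e0) in hG.
move: hJ hG hVI; move: (dot (grad (pG P) u) (u' - u)) (rlin i u p (u - v)) => a b.
move: (dot (u' - u) (u' - u)) (dot _ (resid P u')) (dot _ (resid P u)) => c d d'.
move: (bregman K v u) (bregman K v u') (bregman K u' u) => e1 e2 e3.
move: (fine (pJ_ P (submxcol u i))) (fine (pJ_ P (submxcol u' i))).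
move: (fine (pJ_ P (submxcol v i))) (pG P u) (pG P u') => j1 g1 g2 j2 j3.
(* Multiplied by [eps], the identity for J matches the products in the other inequalities, so linear
   arithmetic suffices. *)
move: (\sum_j _) (\sum_j _) => s1 s2 /(congr1 (fun x => eps * x)).
by lra.
Qed.

Lemma coordinate_step us ps v y :
  domJ P u -> feas_set P v -> domJ P v ->
  eps / N%:R * (Lr P u' y - Lr P v (qvec P gamma u p))
    + Lam us ps v y u' (p + rho *: resid P u')
  <= Lam us ps v y u p
     + eps * ((Lr P u (qvec P gamma u p) - Lr P v (qvec P gamma u p)) / N%:R
              - (rlin i u p (u - v) + fine (pJ_ P (submxcol u i))
                 - fine (pJ_ P (submxcol v i)))).
Proof.
move=> du fv dv; have hc := coordinate_descent du fv dv.
have hD := bregman_ge fu fu'.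
have hl := lambda_max_gram_ge (pA P) (u' - u); rewrite -residB in hl.
have LqE z : Lr P z (qvec P gamma u p) =
    Fr P z + (dot p (resid P z) + gamma * dot (resid P u) (resid P z)).
  by rewrite /Lr /qvec dotDl dotZl.
rewrite !(LqE u) !(LqE u') (dotC (resid P u) (resid P u')) in hc *.
rewrite /Lam !enorm_sqr [p + rho *: _ - y]addrAC.
move: (Lr P v _) => V; rewrite /Lr; move: (Fr P us + _) => L0.
rewrite dot_sqrB in hl.
rewrite dot_sqrDZ (dotBl (resid P u') p y).
rewrite dotDl dotZl.
have r'0 := dot_ge0 (resid P u'); have dd0 := dot_ge0 (u' - u).
move: hc hD hl dd0 r'0; move: (dot (u' - u) _) (rlin _ _ _ _ + _ - _) => dd Y.
move: (bregman K v u) (bregman K v u') (bregman K u' u) => Dv Dv' D.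
move: (dot (resid P u') (resid P u')) (dot (resid P u') (resid P u)) => r'r' r'r.
move: (dot (resid P u) (resid P u)) (dot p (resid P u')) => rr pr'.
move: (dot p _) (dot y _) (dot (p - y) _) (Fr P u') (Fr P u) => pr yr' py F' F.
move=> hc hD hl dd0 r'0; apply: rpdc_step_real hc hD hl _ _ => //.
- by rewrite ltr0n (ltn_trans _ N2).
- exact: eps_gt0 QA.
- exact: rho_gt0 QA.
- exact: ltW gamma_gt0.
- exact: ltW (eps_lt QA).
- exact: ltW rho_mul_lt.
Qed.

End Argmin.
(** Summed over [i], the block terms form the full linearization at [u], and convexity of G makes
    the total error nonpositive. *)
Lemma rpdc_step us ps v y u p (up : 'I_N -> vecU) :
  feas_set P u -> domJ P u -> (forall i, feas_set P (up i)) ->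
  (forall i w, feas_set P w ->
    (rpdc_obj P K gamma eps i u p (up i) <= rpdc_obj P K gamma eps i u p w)%E) ->
  (forall i j, j != i -> submxcol (up i) j = submxcol u j) ->
  feas_set P v -> domJ P v ->
  \sum_i (eps / N%:R * (Lr P (up i) y - Lr P v (qvec P gamma u p))
          + Lam us ps v y (up i) (p + rho *: resid P (up i)))
  <= N%:R * Lam us ps v y u p.
Proof.
move=> fu du fup upmin upblock fv dv.
have N0 : 0 < N%:R :> R by rewrite ltr0n (ltn_trans _ N2).
apply: le_trans (ler_sum _ (fun i _ => coordinate_step fu (fup i) (upmin i)
  (@upblock i) us ps y du fv dv)) _.
rewrite big_split /= sumr_const card_ord -mulr_sumr sumrB sumr_const card_ord.
rewrite -(mulr_natl (Lam _ _ _ _ _ _)) -(mulr_natl (_ / _)) gerDl.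
rewrite pmulr_rle0 ?(eps_gt0 QA) // mulrC divfK ?gt_eqF //.
rewrite sumrB big_split /= rlin_sum subr_le0.
have := convex_grad v (G_convex PA) (G_diff PA u).
rewrite -opprB (dotNr (grad (pG P) u)) /Lr /Fr -residB.
rewrite (dotBr (qvec P gamma u p)).
move: (dot (grad (pG P) u) _) (dot _ (resid P u)) (dot _ (resid P v)) => a b c.
by move: (pG P u) (pG P v) (\sum_i _) (\sum_i _) => g1 g2 s1 s2; lra.
Qed.

(** * Lower bounds on Lambda by completing squares *)

Section Bounds.
Context {us : vecU} {ps : vecP} (saddle : saddle_point P us ps).

Lemma d1_gt0 : 0 < d1 P beta gamma eps.
Proof.
have N3 := natN_gt2; have e0 := eps_gt0 QA; have g0 := gamma_gt0.
have l0 := lambda_max_gram_ge0 (pA P); have B0 := BG_ge0 PA.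
have b0 := beta_gt0 CA; have := eps_lt QA; rewrite mulrDr => h.
have eB : 0 <= eps * BG by rewrite mulr_ge0 // ltW.
rewrite /d1 lt_min; apply/andP; split; last first.
  by rewrite divr_gt0 // !mulr_gt0 //; lra.
rewrite mulr_gt0 ?invr_gt0 ?mulr_gt0 //; first lra.
(* The product of [eps], [gamma] and the eigenvalue is below [beta], since [eps * BG] is
   nonnegative, and [beta < N * beta]. *)
rewrite subr_gt0 -mulrA; apply: (@lt_trans _ _ beta); first lra.
by rewrite ltr_pMl //; lra.
Qed.

Lemma d3_ge0 : 0 <= d3 N gamma eps.
Proof.
have N3 := natN_gt2; have e0 := eps_gt0 QA; have g0 := gamma_gt0.
apply: divr_ge0; first by rewrite mulr_ge0 ?sqr_ge0 // ltW.
by rewrite ltW // !mulr_gt0 //; lra.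
Qed.

(** The Lagrangian gap at [p] is the gap at [ps], which is nonnegative, plus the pairing of [p - ps]
    with the residual. Completing the square with the residual term of Lambda leaves exactly the
    [d3] term. *)
Lemma Lam_ge v y u p : feas_set P u -> feas_set P v -> domJ P u ->
  - d3 N gamma eps * dot (p - ps) (p - ps) <= Lam us ps v y u p.
Proof.
move=> fu fv du; have N3 := natN_gt2; have e0 := eps_gt0 QA.
have g0 := gamma_gt0; have r0 := rho_gt0 QA; have b0 := beta_gt0 CA.
have hF := saddle_le PA saddle fu du.
have hb : 0 <= bregman K v u.
  apply: le_trans (bregman_ge fu fv).
  by rewrite mulr_ge0 ?dot_ge0 //; lra.
(* The coefficient that makes the cross term match the weight [eps * (N - 1) / N] of the gap. *)
have := dot_ge0 (resid P u + ((N%:R - 1) / ((N%:R - 2) * gamma)) *: (p - ps)).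
rewrite dot_sqrDZ (dotC (resid P u)) /Lam !enorm_sqr (saddle_Lr PA saddle).
move: hF; rewrite /Lr (dotBl (resid P u)) /d3.
have hy : 0 <= eps / (2 * N%:R * rho) * dot (p - y) (p - y).
  by rewrite mulr_ge0 ?dot_ge0 // divr_ge0 ?mulr_ge0 ?(ltW e0) ?(ltW r0) //; lra.
move: hb hy; move: (bregman K v u) (_ * dot (p - y) (p - y)) => bk qy hb hy.
move: (dot p _) (dot ps _) (dot (p - ps) _) (dot (resid P u) _) => x z pp rr.
move: (Fr P u) (Fr P us) => F Fs hF hs.
have c0 : 0 < eps * (N%:R - 2) * gamma / (2 * N%:R).
  by rewrite divr_gt0 ?mulr_gt0 //; lra.
have a0 : 0 < eps * (N%:R - 1) / N%:R by rewrite divr_gt0 ?mulr_gt0 //; lra.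
have {}hF : 0 <= eps * (N%:R - 1) / N%:R * (F + z - Fs).
  by rewrite mulr_ge0 ?(ltW a0) //; lra.
have {}hs := mulr_ge0 (ltW c0) hs.
rewrite -subr_ge0; move: hs hF; move: N3; move: (N%:R : R) => n N3 hs hF.
rewrite (_ : _ - _ = bk + qy + eps * (n - 1) / n * (F + z - Fs)
  + eps * (n - 2) * gamma / (2 * n) *
    (rr + 2 * ((n - 1) / ((n - 2) * gamma)) * (x - z)
     + ((n - 1) / ((n - 2) * gamma)) ^+ 2 * pp)).
  by rewrite !addr_ge0.
by field; rewrite !gt_eqF //; lra.
Qed.

(** At the saddle point the residual is the matrix applied to [u - us], so part of the Bregman
    distance pays for raising the weight [N - 2] of the squared residual to [N - 1]. After
    completing the square, the bound on [rho] leaves a positive multiple of the squared dual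
    distance. *)
Lemma Lam_saddle_ge u p : feas_set P u -> domJ P u ->
  d1 P beta gamma eps * dot (p - ps) (p - ps) <= Lam us ps us ps u p.
Proof.
move=> fu du; have N3 := natN_gt2; have e0 := eps_gt0 QA.
have g0 := gamma_gt0; have r0 := rho_gt0 QA; have b0 := beta_gt0 CA.
have hF := saddle_le PA saddle fu du.
have hb := bregman_ge fu saddle.1.
have hl := lambda_max_gram_ge (pA P) (u - us).
rewrite -residB (saddle_resid PA saddle) subr0 in hl.
rewrite -(opprB u) dotNl dotNr opprK in hb.
have l0 := lambda_max_gram_ge0 (pA P); have B0 := BG_ge0 PA.
have he := eps_lt QA.
have := dot_ge0 (resid P u + gamma^-1 *: (p - ps)).
rewrite dot_sqrDZ (dotC (resid P u)) /Lam !enorm_sqr (saddle_Lr PA saddle).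
have pp0 := dot_ge0 (p - ps); have dd0 := dot_ge0 (u - us).
have hd1 : d1 P beta gamma eps <= eps / (4 * N%:R * gamma).
  by rewrite /d1 ge_min lexx orbT.
apply: (fun h h' => le_trans (ler_wpM2r pp0 hd1) (h h')).
have hr := rho_mul_lt.
move: hF hb hl pp0 dd0; rewrite /Lr (dotBl (resid P u)).
move: (bregman K us u) (dot (u - us) _) => bk dd.
move: (dot p _) (dot ps _) (dot (p - ps) _) (dot (resid P u) _) => x z pp rr.
move: l0 he; move: (lambda_max _) => lam l0 he.
move: (Fr P u) (Fr P us) => F Fs hF hb hl pp0 dd0 hs.
move: hr N3; move: (N%:R : R) => n hr N3.
have eB : 0 <= eps * BG by rewrite mulr_ge0 // ltW.
have c0 : 0 <= eps * (n - 1) * gamma / (2 * n).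
  by rewrite ltW // divr_gt0 ?mulr_gt0 //; lra.
have a0 : 0 <= eps * (n - 1) / n by rewrite ltW // divr_gt0 ?mulr_gt0 //; lra.
have k0 : 0 <= eps * gamma / (2 * n) by rewrite ltW // divr_gt0 ?mulr_gt0 //; lra.
have m0 : 0 <= eps / (4 * n * rho * gamma).
  by rewrite ltW // divr_gt0 ?mulr_gt0 //; lra.
have h1 : 0 <= eps * (n - 1) / n * (F + z - Fs) by rewrite mulr_ge0 //; lra.
have h2 := mulr_ge0 c0 hs.
have h3 : 0 <= eps * gamma / (2 * n) * (lam * dd - rr) by rewrite mulr_ge0 //; lra.
(* The coefficient here is [eps / (2 * n * rho)] less the cost [eps * (n - 1) / (2 * n * gamma)] of
   the square and less the claimed [eps / (4 * n * gamma)]. *)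
have h4 : 0 <= eps / (4 * n * rho * gamma) * ((2 * gamma - rho * (2 * n - 1)) * pp).
  by apply: mulr_ge0 => //; apply: mulr_ge0 => //; lra.
have h5 : 0 <= (beta * n - eps * gamma * lam) / (2 * n) * dd.
  apply: mulr_ge0 => //; apply: divr_ge0; last by lra.
  rewrite mulrDr in he; have : beta * 1 <= beta * n by rewrite ler_pM2l //; lra.
  by lra.
rewrite -subr_ge0.
rewrite (_ : _ - _ = (bk - beta / 2 * dd) + eps * (n - 1) / n * (F + z - Fs)
  + eps * (n - 1) * gamma / (2 * n) *
      (rr + 2 * gamma^-1 * (x - z) + gamma^-1 ^+ 2 * pp)
  + eps * gamma / (2 * n) * (lam * dd - rr)
  + eps / (4 * n * rho * gamma) * ((2 * gamma - rho * (2 * n - 1)) * pp)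
  + (beta * n - eps * gamma * lam) / (2 * n) * dd).
  have h0 : 0 <= bk - beta / 2 * dd by rewrite subr_ge0.
  by do 5 apply: addr_ge0 => //.
by field; rewrite !gt_eqF //; lra.
Qed.

End Bounds.

End OneStep.

(** * Sums over histories of drawn indices *)

Section TupleSums.
Context {R : realType} {N : nat}.

Lemma sum_tuple_rcons (V : nmodType) t (f : seq 'I_N -> V) :
  \sum_(s : t.+1.-tuple 'I_N) f s
  = \sum_(s : t.-tuple 'I_N) \sum_i f (rcons s i).
Proof.
rewrite pair_big /=.
have h_inj : injective (fun x : t.-tuple 'I_N * 'I_N => [tuple of rcons x.1 x.2]).
  move=> [s i] [s' i'] /(congr1 val) /= /rcons_inj [e ->].
  by congr (_, _); apply: val_inj.
rewrite (reindex (fun x : t.-tuple 'I_N * 'I_N => [tuple of rcons x.1 x.2])) //=.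
apply/onW_bij/inj_card_bij => //.
by rewrite card_prod !card_tuple card_ord expnSr.
Qed.

(** Sums over tuples stand for expectations: the hypothesis is the conditional one-step inequality
    times [N], and induction peels off the last draw. *)
Lemma sum_supermartingale (X : seq 'I_N -> R) (c : seq 'I_N -> seq 'I_N -> R) t :
  (forall s, \sum_i (c s (rcons s i) + X (rcons s i)) <= N%:R * X s) ->
  \sum_(s : t.-tuple 'I_N) (\sum_(k < t) c (take k s) (take k.+1 s) + X s)
  <= (N ^ t)%:R * X [::].
Proof.
move=> h; elim: t => [|t IH].
  rewrite (eq_bigr (fun=> X [::])) => [|s _]; last by rewrite tuple0 big_ord0 add0r.
  by rewrite sumr_const card_tuple expn0 mulr1n mul1r.
rewrite (sum_tuple_rcons t
  (fun s => \sum_(k < t.+1) c (take k s) (take k.+1 s) + X s)).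
rewrite expnS natrM -mulrA; apply: le_trans (ler_wpM2l (ler0n _ _) IH).
rewrite mulr_sumr; apply: ler_sum => s _; rewrite mulrDr.
apply: le_trans (lerD (lexx _) (h s)).
rewrite (eq_bigr (fun i => \sum_(k < t) c (take k s) (take k.+1 s)
    + (c s (rcons s i) + X (rcons s i)))) => [|i _].
  by rewrite big_split /= sumr_const card_ord -(mulr_natl (\sum_(k < t) _)).
(* Prefixes of length at most [t] do not see the last draw; the one of length [t.+1] is the whole
   history. *)
rewrite big_ord_recr /= addrA; congr (_ + _ + _); last first.
  by rewrite -cats1 take_size_cat ?size_tuple // take_oversize ?size_cat ?size_tuple ?addn1.
by apply: eq_bigr => k _; rewrite -cats1 !takel_cat ?size_tuple // ltnW.
Qed.

End TupleSums.

(** * Extended-valued expectation over uniform draws *)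

Section Expectation.
Context {R : realType} {N t : nat}.
Hypothesis N0 : (0 < N)%N.
Local Notation tuples := (t.-tuple 'I_N).
Implicit Types X Y : tuples -> \bar R.

Lemma expect_weight_gt0 : 0 < (N ^ t)%:R^-1 :> R.
Proof. by rewrite invr_gt0 ltr0n expn_gt0 N0. Qed.

Lemma expect_fin (f : tuples -> R) :
  expect (fun s => (f s)%:E) = ((N ^ t)%:R^-1 * \sum_s f s)%:E.
Proof. by rewrite /expect sumEFin. Qed.

Lemma expect_le X Y : (forall s, X s <= Y s)%E -> (expect X <= expect Y)%E.
Proof.
move=> h; apply: lee_wpmul2l; first by rewrite lee_fin ltW // expect_weight_gt0.
by apply: lee_sum => s _; exact: h.
Qed.

(** A tuple must exist, since an empty sum would be 0 instead of infinite. *)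
Let s0 : tuples := [tuple of nseq t (Ordinal N0)].

Lemma expect_infty X : (forall s, X s = +oo)%E -> expect X = +oo%E.
Proof.
move=> h; rewrite /expect (_ : (\sum_s X s)%E = +oo%E).
  by rewrite gt0_muley // lte_fin expect_weight_gt0.
by apply/esum_eqyP => [s _|]; [rewrite h | exists s0; rewrite mem_index_enum].
Qed.

Lemma expect_ninfty X : (forall s, X s = -oo)%E -> expect X = -oo%E.
Proof.
move=> h; rewrite /expect (_ : (\sum_s X s)%E = -oo%E).
  by rewrite gt0_muleNy // lte_fin expect_weight_gt0.
by apply/esum_eqNyP; exists s0; rewrite mem_index_enum.
Qed.

Lemma expect_cst (x : \bar R) : expect (fun _ : tuples => x) = x.
Proof.
case: x => [r| |]; [|exact: expect_infty|exact: expect_ninfty].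
rewrite expect_fin sumr_const card_tuple card_ord -(mulr_natl r).
by rewrite mulrA mulVf ?mul1r // -invr_eq0 gt_eqF // expect_weight_gt0.
Qed.

End Expectation.

(** The limit [a] to 0; it serves because the supremum in [d5] runs over an open ball, whose radius
    can only be approached. *)
Lemma le_shrink (R : realFieldType) (x y : R) : 0 <= x ->
  (forall a, 0 < a < 1 -> (1 - a) * x <= y) -> x <= y.
Proof.
move=> x0 h; rewrite leNgt; apply/negP => yx.
have y0 : 0 <= y by apply: le_trans (h 2^-1 _); [rewrite mulr_ge0 | ]; lra.
have xp : 0 < x by lra.
(* For this [a], [(1 - a) * x] is the midpoint of [x] and [y], which exceeds [y]. *)
have a0 : 0 < (x - y) / (2 * x) by rewrite divr_gt0 //; lra.
have a1 : (x - y) / (2 * x) < 1 by rewrite ltr_pdivrMr; lra.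
have := h _ (introT andP (conj a0 a1)).
have -> : (1 - (x - y) / (2 * x)) * x = (x + y) / 2 by field; rewrite gt_eqF.
by lra.
Qed.

(** * Telescoping along a run of the method *)

Section Run.
Context {R : realType} {N m : nat} {n_ : 'I_N -> nat} {P : problem R m n_}.
Context {K : 'cV[R]_(\sum_i n_ i) -> R^o} {BG beta B gamma eps rho : R}.
Context {u : seq 'I_N -> 'cV[R]_(\sum_i n_ i)} {p : seq 'I_N -> 'cV[R]_m}.
Context {us : 'cV[R]_(\sum_i n_ i)} {ps : 'cV[R]_m}.
Hypotheses (N2 : (2 < N)%N) (PA : problem_assumptions P BG)
  (CA : core_assumptions P K beta B)
  (QA : param_assumptions P beta BG gamma eps rho)
  (run : rpdc P K gamma eps rho u p) (saddle : saddle_point P us ps).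
Implicit Types (v : 'cV[R]_(\sum_i n_ i)) (y : 'cV[R]_m).

Local Notation Lm := (@Lam R N m n_ P K gamma eps rho us ps).
Local Notation d31 := (d3 N gamma eps / d1 P beta gamma eps).
Local Notation q := (fun s => qvec P gamma (u s) (p s)).

Definition hr v' y' v y : R := Lm v y v' y' + d31 * Lm us ps v' y'.

Let N0 : (0 < N)%N := ltn_trans (ltn0Sn 1) N2.

Let Nr0 : 0 < N%:R :> R.
Proof. by rewrite ltr0n. Qed.

Lemma hfun_fin v' y' v y : domJ P v' ->
  hfun P K beta gamma eps rho us ps (v', y') (v, y) = (hr v' y' v y)%:E.
Proof.
move=> dv'; rewrite /hfun /Lambda /= !(lagr_fin _ dv').
by rewrite (lagr_fin _ (saddle_domJ PA saddle)).
Qed.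

Lemma hfun_infty v' y' w : ~ domJ P v' ->
  hfun P K beta gamma eps rho us ps (v', y') w = +oo%E.
Proof.
move=> dv'.
have a0 : 0 < eps * (N%:R - 1) / N%:R.
  have := natN_gt2 (R := R) N2; have := eps_gt0 QA => e0 N3.
  by rewrite divr_gt0 ?mulr_gt0 //; lra.
have L z : Lambda P K gamma eps rho us ps (v', y') z = +oo%E.
  rewrite /Lambda /= (lagr_infty PA) // (lagr_fin _ (saddle_domJ PA saddle)).
  by rewrite addye // gt0_muley ?lte_fin // addey // addye.
(* A zero coefficient times infinity is 0, so this case is separate. *)
have [d3z|d3nz] := eqVneq (d3 N gamma eps) 0.
  by rewrite /hfun !L d3z mul0r mul0e adde0.
rewrite /hfun !L gt0_muley // lte_fin divr_gt0 ?(d1_gt0 PA CA QA N2) //.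
by rewrite lt_neqAle eq_sym d3nz (d3_ge0 QA N2).
Qed.

(** The first Lambda is at least minus [d3] times the squared dual distance to [ps]; the second,
    scaled by [d3 / d1], is at least that same amount. *)
Lemma hr_ge0 v' y' v y : feas_set P v' -> domJ P v' -> feas_set P v ->
  0 <= hr v' y' v y.
Proof.
move=> fv' dv' fv; have d10 := d1_gt0 PA CA QA N2; have d30 := d3_ge0 QA N2.
have h1 := Lam_ge PA CA QA N2 saddle y y' fv' fv dv'.
have := Lam_saddle_ge PA CA QA N2 saddle y' fv' dv'.
rewrite -(ler_pM2l (divr_gt0 ltr01 d10)) => h2.
have {}h2 := ler_wpM2l d30 h2.
rewrite /hr; move: h1 h2; rewrite div1r !mulrA.
rewrite -[_ / d1 _ _ _ _ * d1 _ _ _ _]mulrA mulVf ?gt_eqF // mulr1.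
by lra.
Qed.

Lemma hfun_ge0 w w' : feas_set P w.1 -> feas_set P w'.1 ->
  (0 <= hfun P K beta gamma eps rho us ps w w')%E.
Proof.
case: w w' => [v' y'] [v y] /= fv' fv.
have [dv'|dv'] := pselect (domJ P v'); last by rewrite hfun_infty.
by rewrite hfun_fin // lee_fin hr_ge0.
Qed.

Lemma iterate_feas s : feas_set P (u s).
Proof.
by case: (lastP s) => [|s' i]; [exact: rpdc_init run | exact: rpdc_feas run _ _].
Qed.

Section FiniteStart.
Hypothesis du0 : domJ P (u [::]).

Lemma iterate_domJ s : domJ P (u s).
Proof.
elim/last_ind: s => [//|s i]; apply: (argmin_domJ PA).
- by move=> w fw; exact: rpdc_min run _ _ _ fw.
- by move=> j; exact: rpdc_block run _ _ _.
Qed.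

Lemma iterate_step s v y : feas_set P v -> domJ P v ->
  \sum_i (eps / N%:R * (Lr P (u (rcons s i)) y - Lr P v (q s))
          + Lm v y (u (rcons s i)) (p (rcons s i)))
  <= N%:R * Lm v y (u s) (p s).
Proof.
move=> fv dv.
rewrite (eq_bigr (fun i => eps / N%:R * (Lr P (u (rcons s i)) y - Lr P v (q s))
  + Lm v y (u (rcons s i)) (p s + rho *: resid P (u (rcons s i))))) => [|i _].
  apply: (rpdc_step PA CA QA N2 us ps y (iterate_feas s) (iterate_domJ s)) => //.
  - by move=> i; exact: iterate_feas.
  - by move=> i w fw; exact: rpdc_min run _ _ _ fw.
  - by move=> i j; exact: rpdc_block run _ _ _.
by rewrite (rpdc_dual run).
Qed.

(* [w = w^*]: all the gap terms are nonnegative, so that Lambda(w^k, w^* ) is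
   a supermartingale. *)
Lemma expected_Lam_saddle t :
  \sum_(s : t.-tuple 'I_N) Lm us ps (u s) (p s)
  <= (N ^ t)%:R * Lm us ps (u [::]) (p [::]).
Proof.
have dus := saddle_domJ PA saddle.
pose c s s' := eps / N%:R * (Lr P (u s') ps - Lr P us (q s)).
have c0 s s' : 0 <= c s s'.
  rewrite /c mulr_ge0 //; first by rewrite divr_ge0 // ltW // (eps_gt0 QA).
  rewrite (saddle_Lr PA saddle) subr_ge0.
  exact (saddle_le PA saddle (iterate_feas s') (iterate_domJ s')).
have step s := iterate_step s ps saddle.1 dus.
apply: le_trans (sum_supermartingale (X := fun s => Lm us ps (u s) (p s))
  (c := c) t step).
by apply: ler_sum => s _; rewrite lerDr sumr_ge0.
Qed.

Lemma dual_telescope t (s : t.-tuple 'I_N) :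
  \sum_(k < t) rho *: resid P (u (take k.+1 s)) = p s - p [::].
Proof.
have h k : (k <= t)%N ->
    \sum_(j < k) rho *: resid P (u (take j.+1 s)) = p (take k s) - p [::].
  elim: k => [|k IH] kt; first by rewrite big_ord0 take0 subrr.
  rewrite big_ord_recr /= IH ?(ltnW kt) //.
  rewrite (take_nth (tnth s (Ordinal kt))) ?size_tuple // (rpdc_dual run).
  by rewrite addrAC.
by rewrite h // take_oversize // size_tuple.
Qed.

Lemma Lam_dual_shift v y v' y' : Lm v y v' y' - Lm v 0 v' y'
  = eps / (2 * N%:R * rho) * (dot y y - 2 * dot y y').
Proof.
by rewrite /Lam !enorm_sqr subr0 dot_sqrB (dotC y'); ring.
Qed.

(* The only dependence of the path sum on y is through
   sum_k <y, A u^(k+1) - b> = <y, p^(t+1) - p^0> / rho, which Lambda absorbs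
   exactly.  So y may depend on the whole path. *)
Lemma expected_path_sum t v (y : t.-tuple 'I_N -> 'cV[R]_m) :
  feas_set P v -> domJ P v ->
  \sum_(s : t.-tuple 'I_N)
    (\sum_(k < t) eps / N%:R * (Lr P (u (take k.+1 s)) (y s)
                               - Lr P v (q (take k s)))
     + Lm v (y s) (u s) (p s))
  <= \sum_(s : t.-tuple 'I_N) Lm v (y s) (u [::]) (p [::]).
Proof.
move=> fv dv; have r0 := rho_gt0 QA.
(* The supermartingale bound is taken at the path-independent value 0 of [y]; both sides are then
   shifted to [y s]. *)
pose c s s' := eps / N%:R * (Lr P (u s') 0 - Lr P v (q s)).
have := sum_supermartingale (X := fun s => Lm v 0 (u s) (p s)) (c := c) t
  (fun s => iterate_step s 0 fv dv).
have -> : (N ^ t)%:R * Lm v 0 (u [::]) (p [::])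
    = \sum_(s : t.-tuple 'I_N) Lm v 0 (u [::]) (p [::]).
  by rewrite sumr_const card_tuple card_ord mulr_natl.
rewrite -subr_ge0 -[in X in _ -> X]subr_ge0 -!sumrB => h.
apply: le_trans h _; rewrite le_eqVlt; apply/orP; left; apply/eqP.
apply: eq_bigr => s _.
have -> : \sum_(k < t) eps / N%:R * (Lr P (u (take k.+1 s)) (y s)
      - Lr P v (q (take k s)))
    = \sum_(k < t) c (take k s) (take k.+1 s)
      + eps / (N%:R * rho) * (dot (y s) (p s) - dot (y s) (p [::])).
  rewrite -dotBr -dual_telescope dot_sumr mulr_sumr -big_split /=.
  apply: eq_bigr => k _; rewrite /c /Lr dot0l dotZr.
  by field; rewrite !gt_eqF.
have := Lam_dual_shift v (y s) (u s) (p s).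
have := Lam_dual_shift v (y s) (u [::]) (p [::]).
move: (Lm v (y s) (u s) (p s)) (Lm v 0 (u s) (p s)) => a b.
move: (Lm v (y s) _ _) (Lm v 0 _ _) => a' b'.
move=> /(canRL (subrK _)) -> /(canRL (subrK _)) ->.
by field; rewrite !gt_eqF.
Qed.

Lemma expected_gap_sum t v (y : t.-tuple 'I_N -> 'cV[R]_m) :
  feas_set P v -> domJ P v ->
  \sum_(s : t.-tuple 'I_N)
    \sum_(k < t) (Lr P (u (take k.+1 s)) (y s) - Lr P v (q (take k s)))
  <= N%:R / eps * \sum_(s : t.-tuple 'I_N) hr (u [::]) (p [::]) v (y s).
Proof.
move=> fv dv; have e0 := eps_gt0 QA.
have d10 := d1_gt0 PA CA QA N2; have d30 := d3_ge0 QA N2.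
have h1 := expected_path_sum y fv dv.
have d31_ge0 : 0 <= d31 by rewrite divr_ge0 // ltW.
have h2 := ler_wpM2l d31_ge0 (expected_Lam_saddle t).
have h3 : 0 <= \sum_(s : t.-tuple 'I_N) hr (u s) (p s) v (y s).
  by apply: sumr_ge0 => s _; apply: hr_ge0 => //;
    [exact: iterate_feas | exact: iterate_domJ].
rewrite -ler_pdivrMl ?divr_gt0 // invf_div mulr_sumr.
rewrite (eq_bigr (fun s : t.-tuple 'I_N => \sum_(k < t) eps / N%:R *
  (Lr P (u (take k.+1 s)) (y s) - Lr P v (q (take k s))))) => [|s _]; last first.
  by rewrite mulr_sumr.
rewrite big_split /= in h1; rewrite /hr big_split /= in h3.
rewrite /hr big_split /= sumr_const card_tuple card_ord -(mulr_natl (d31 * _)).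
rewrite -mulr_sumr in h3.
by move: h1 h2 h3; lra.
Qed.

End FiniteStart.
End Run.

(** * Ergodic averages: gap, feasibility and primal value *)

Section Averages.
Context {R : realType} {N m : nat} {n_ : 'I_N -> nat} {P : problem R m n_}.
Context {K : 'cV[R]_(\sum_i n_ i) -> R^o} {BG beta B gamma eps rho : R}.
Context {u : seq 'I_N -> 'cV[R]_(\sum_i n_ i)} {p : seq 'I_N -> 'cV[R]_m}.
Context {us : 'cV[R]_(\sum_i n_ i)} {ps : 'cV[R]_m}.
Hypotheses (N2 : (2 < N)%N) (PA : problem_assumptions P BG)
  (CA : core_assumptions P K beta B)
  (QA : param_assumptions P beta BG gamma eps rho)
  (run : rpdc P K gamma eps rho u p) (saddle : saddle_point P us ps).
Implicit Types (v : 'cV[R]_(\sum_i n_ i)) (y : 'cV[R]_m).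

Local Notation hrr := (@hr R N m n_ P K beta gamma eps rho us ps).

Let N0 : (0 < N)%N := ltn_trans (ltn0Sn 1) N2.

Lemma ubar_feas t s : feas_set P (ubar u t s).
Proof.
apply: (jensen_mean (S := feas_set P) (f := fun=> 0)
  (x := fun k => u (take k.+1 s)) _ _ _).1.
- by move=> v w a fv fw; exact: (feas_convex PA).
- by move=> v w a _ _ _; rewrite !mulr0 !mul0r; lra.
- by move=> k _; exact: iterate_feas run _.
Qed.

Section FiniteStart.
Hypothesis du0 : domJ P (u [::]).

Let du := iterate_domJ PA run du0.

Let jensen t s := jensen_mean (t := t) (x := fun k => u (take k.+1 s))
  (fun v w a => @domJ_convex R N m n_ P BG PA v w a) (Fr_convex PA)
  (fun k _ => du (take k.+1 s)).

Lemma ubar_domJ t s : domJ P (ubar u t s).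
Proof. exact: (jensen t s).1. Qed.

(** The Lagrangian is convex in the primal and affine in the dual variable, so the gap of the
    averages is at most the average of the gaps. *)
Lemma gap_average t s v y :
  Lr P (ubar u t s) y - Lr P v (pbar P gamma u p t s) <=
  t.+1%:R^-1 * \sum_(k < t.+1)
    (Lr P (u (take k.+1 s)) y - Lr P v (qvec P gamma (u (take k s)) (p (take k s)))).
Proof.
have hF := (jensen t s).2.
have t0 : t.+1%:R^-1 * t.+1%:R = 1 :> R by rewrite mulVf // pnatr_eq0.
move: hF; rewrite /Lr; move: (Fr P) => F hF.
rewrite sumrB !big_split /= sumr_const card_ord -(mulr_natl (F v)).
rewrite mulrBr !mulrDr (mulrA _ t.+1%:R) t0 mul1r.
rewrite [ubar u t s]/ubar [pbar _ _ _ _ _ _]/pbar.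
rewrite (resid_mean P t (fun k => u (take k.+1 s))) dotZr dotZl dot_sumr.
rewrite (dotC (\sum_(k < t.+1) _)) dot_sumr.
under [X in _ - (_ + _ * X)]eq_bigr do rewrite dotC.
by rewrite lerD2r lerD2r.
Qed.

Lemma expected_gap t v (y : t.+1.-tuple 'I_N -> 'cV[R]_m) :
  feas_set P v -> domJ P v ->
  \sum_(s : t.+1.-tuple 'I_N)
    (Lr P (ubar u t s) (y s) - Lr P v (pbar P gamma u p t s))
  <= N%:R / (eps * t.+1%:R) *
     \sum_(s : t.+1.-tuple 'I_N) hrr (u [::]) (p [::]) v (y s).
Proof.
move=> fv dv; have h := expected_gap_sum N2 PA CA QA run saddle du0 y fv dv.
have t0 : 0 <= t.+1%:R^-1 :> R by rewrite invr_ge0.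
rewrite invfM mulrA [_ / t.+1%:R]mulrC -mulrA.
apply: le_trans (ler_wpM2l t0 h); rewrite mulr_sumr.
by apply: ler_sum => s _; exact: gap_average.
Qed.

End FiniteStart.

Lemma expect_gap t v (y : t.+1.-tuple 'I_N -> 'cV[R]_m) : feas_set P v ->
  (expect (fun s : t.+1.-tuple 'I_N =>
     lagr P (ubar u t s) (y s) - lagr P v (pbar P gamma u p t s))
   <= (N%:R / (eps * t.+1%:R))%:E
      * expect (fun s => hfun P K beta gamma eps rho us ps
                           (u [::], p [::]) (v, y s)))%E.
Proof.
move=> fv.
have c0 : 0 < N%:R / (eps * t.+1%:R) :> R.
  by rewrite divr_gt0 ?ltr0n // mulr_gt0 ?ltr0n // (eps_gt0 QA).
(* An infinite J at the start makes the right side [+oo]; an infinite J at [v] makes the left side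
   [-oo]. *)
have [du0|du0] := pselect (domJ P (u [::])); last first.
  rewrite [X in (_ <= _ * X)%E](expect_infty N0) => [|s].
    by rewrite gt0_muley ?lte_fin // leey.
  by apply: (hfun_infty N2 PA CA QA saddle).
have [dv|dv] := pselect (domJ P v); last first.
  rewrite [X in (X <= _)%E](expect_ninfty N0) ?leNye // => s.
  by rewrite (lagr_infty PA _ dv) (lagr_fin _ (ubar_domJ du0 t s)).
have LE (s : t.+1.-tuple 'I_N) : (lagr P (ubar u t s) (y s) - lagr P v (pbar P gamma u p t s))%E
    = (Lr P (ubar u t s) (y s) - Lr P v (pbar P gamma u p t s))%:E.
  by rewrite (lagr_fin _ (ubar_domJ du0 t s)) (lagr_fin _ dv).
have hE (s : t.+1.-tuple 'I_N) : hfun P K beta gamma eps rho us ps (u [::], p [::]) (v, y s)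
    = (hrr (u [::]) (p [::]) v (y s))%:E by apply: (hfun_fin PA saddle).
rewrite (funext LE) (funext hE) !expect_fin -EFinM lee_fin mulrCA; apply: ler_wpM2l.
  by rewrite invr_ge0.
exact: expected_gap.
Qed.

Lemma primal_gap_ge t s : domJ P (u [::]) ->
  - (enorm ps * enorm (resid P (ubar u t s))) <= Fr P (ubar u t s) - Fr P us.
Proof.
move=> du0; have := saddle_le PA saddle (ubar_feas t s) (ubar_domJ du0 t s).
by rewrite /Lr; have := dot_le_enorm ps (resid P (ubar u t s)); lra.
Qed.

(** For a multiplier parallel to the residual, of norm [M'] just below [M], the gap at [us] is the
    primal gap plus [M'] times the norm of the residual. The primal gap costs at most [enorm ps]
    times that norm, leaving the factor [(1 - a) * (M - enorm ps)]. *)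
Lemma expected_feasibility t M d : domJ P (u [::]) -> enorm ps < M ->
  (forall y, enorm y < M -> hrr (u [::]) (p [::]) us y <= d) ->
  (M - enorm ps) * \sum_(s : t.+1.-tuple 'I_N) enorm (resid P (ubar u t s))
  <= N%:R / (eps * t.+1%:R) * ((N ^ t.+1)%:R * d).
Proof.
move=> du0 psM hd; have p0 := enorm_ge0 ps.
apply: le_shrink => [|a /andP[a0 a1]].
  by rewrite mulr_ge0 ?sumr_ge0 // => [|s _]; [lra | exact: enorm_ge0].
pose M' := enorm ps + (1 - a) * (M - enorm ps).
have M'0 : 0 <= M' by rewrite /M' addr_ge0 // mulr_ge0 //; lra.
have M'M : M' < M.
  have : 0 < a * (M - enorm ps) by rewrite mulr_gt0 //; lra.
  by rewrite /M'; lra.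
pose r (s : t.+1.-tuple 'I_N) := resid P (ubar u t s).
(* If [r s = 0] then [y s = 0], the inverse of 0 being 0. *)
pose y s := (M' / enorm (r s)) *: r s.
have yM s : enorm (y s) < M.
  apply: le_lt_trans M'M; rewrite /y enormZ ger0_norm; last first.
    by rewrite divr_ge0 // enorm_ge0.
  have [->|rn] := eqVneq (enorm (r s)) 0; first by rewrite mulr0.
  by rewrite divfK.
have yr s : dot (y s) (r s) = M' * enorm (r s).
  rewrite /y dotZl -enorm_sqr.
  have [->|rn] := eqVneq (enorm (r s)) 0; first by rewrite expr0n !mulr0.
  by rewrite expr2 mulrA divfK.
have h := expected_gap du0 y saddle.1 (saddle_domJ PA saddle).
have c0 : 0 <= N%:R / (eps * t.+1%:R).
  by rewrite divr_ge0 // mulr_ge0 // ltW // (eps_gt0 QA).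
have hs : \sum_(s : t.+1.-tuple 'I_N) hrr (u [::]) (p [::]) us (y s)
    <= (N ^ t.+1)%:R * d.
  apply: le_trans (_ : \sum_(s : t.+1.-tuple 'I_N) d <= _).
    by apply: ler_sum => s _; apply: hd.
  by rewrite sumr_const card_tuple card_ord mulr_natl.
apply: le_trans (ler_wpM2l c0 hs); apply: le_trans h.
rewrite mulrA mulr_sumr; apply: ler_sum => s _.
rewrite (saddle_Lr PA saddle) {1}/Lr yr -/(r s).
by have := primal_gap_ge t s du0; rewrite /M' -/(r s); lra.
Qed.

End Averages.

(** * From the gap bound to feasibility and suboptimality *)

Theorem theorem2 (R : realType) (N m : nat) (n_ : 'I_N -> nat)
    (P : problem R m n_) (K : 'cV[R]_(\sum_i n_ i) -> R^o)
    (BG beta B gamma eps rho : R)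
    (u : seq 'I_N -> 'cV[R]_(\sum_i n_ i)) (p : seq 'I_N -> 'cV[R]_m)
    (us : 'cV[R]_(\sum_i n_ i)) (ps : 'cV[R]_m) (M : R) (t : nat) :
  (2 < N)%N ->
  problem_assumptions P BG ->
  core_assumptions P K beta B ->
  param_assumptions P beta BG gamma eps rho ->
  rpdc P K gamma eps rho u p ->
  saddle_point P us ps ->
  enorm ps < M ->
  (0 < t)%N ->
  let h := hfun P K beta gamma eps rho us ps in
  let w0 := (u [::], p [::]) in
  let D5 := d5 P K beta gamma eps rho us ps M w0 in
  let ub := ubar u t in
  let pb := pbar P gamma u p t in
  [/\ (* nonnegativity of h *)
      forall w w', feas_set P w.1 -> feas_set P w'.1 -> (0 <= h w w')%E,
      (* (i), w fixed *)
      forall v y, feas_set P v ->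
        (expect (fun s : t.+1.-tuple 'I_N =>
                   lagr P (ub s) y - lagr P v (pb s))
         <= (N%:R / (eps * t.+1%:R))%:E * h w0 (v, y))%E,
      (* (i), random dual component *)
      forall v (y : t.+1.-tuple 'I_N -> 'cV[R]_m), feas_set P v ->
        (expect (fun s : t.+1.-tuple 'I_N =>
                   lagr P (ub s) (y s) - lagr P v (pb s))
         <= (N%:R / (eps * t.+1%:R))%:E
            * expect (fun s => h w0 (v, y s)))%E,
      (* (ii) *)
      (expect (fun s : t.+1.-tuple 'I_N => (enorm (resid P (ub s)))%:E)
       <= (N%:R / ((M - enorm ps) * eps * t.+1%:R))%:E * D5)%E
    & (* (iii) *)
      (- ((enorm ps * N%:R / ((M - enorm ps) * eps * t.+1%:R))%:E * D5)
       <= expect (fun s : t.+1.-tuple 'I_N => objF P (ub s) - objF P us))%E /\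
      (expect (fun s : t.+1.-tuple 'I_N => objF P (ub s) - objF P us)
       <= (N%:R / (eps * t.+1%:R))%:E * D5)%E ].
Proof.
move=> N2 PA CA QA run saddle psM _ h w0 D5 ub pb.
have N0 : (0 < N)%N by exact: ltn_trans N2.
have e0 := eps_gt0 QA; have ps0 := enorm_ge0 ps.
have dus := saddle_domJ PA saddle.
have random v y fv := expect_gap N2 PA CA QA run saddle (t := t) (v := v) y fv.
have fixed v y : feas_set P v ->
    (expect (fun s : t.+1.-tuple 'I_N => lagr P (ub s) y - lagr P v (pb s))
     <= (N%:R / (eps * t.+1%:R))%:E * h w0 (v, y))%E.
  by move=> fv; have := random v (fun=> y) fv; rewrite (expect_cst N0).
have hD5 y : enorm y < M -> (h w0 (us, y) <= D5)%E.
  by move=> yM; apply: ereal_sup_ubound; exists y.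
have h_ge0 w w' : feas_set P w.1 -> feas_set P w'.1 -> (0 <= h w w')%E.
  exact: (hfun_ge0 N2 PA CA QA saddle).
have zM : enorm (0 : 'cV[R]_m) < M.
  by rewrite /enorm dot0r sqrtr0 (le_lt_trans ps0).
have D5_ge0 : (0 <= D5)%E.
  apply: le_trans (hD5 _ zM); apply: h_ge0; last exact: saddle.1.
  exact: iterate_feas run _.
have Mps : 0 < M - enorm ps by rewrite subr_gt0.
have t0 : 0 < t.+1%:R :> R by rewrite ltr0n.
have Nr0 : 0 < N%:R :> R by rewrite ltr0n.
have c0 : 0 < N%:R / ((M - enorm ps) * eps * t.+1%:R).
  by rewrite divr_gt0 // !mulr_gt0.
(* A finite [D5] forces J to be finite at the start, so the real-valued estimates apply. *)
have real_case d : D5 = d%:E -> domJ P (u [::]) /\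
    (N ^ t.+1)%:R^-1 * \sum_(s : t.+1.-tuple 'I_N) enorm (resid P (ub s))
    <= N%:R / ((M - enorm ps) * eps * t.+1%:R) * d.
  move=> Dd; have du0 : domJ P (u [::]).
    apply: contrapT => du0; have := hD5 _ zM.
    by rewrite Dd /h (hfun_infty N2 PA CA QA saddle).
  split=> //.
  have hd y : enorm y < M ->
      @hr R N m n_ P K beta gamma eps rho us ps (u [::]) (p [::]) us y <= d.
    by move=> /hD5; rewrite Dd /h /w0 (hfun_fin PA saddle _ _ _ du0) lee_fin.
  have := expected_feasibility N2 PA CA QA run saddle t du0 psM hd.
  have w0' : 0 < (N ^ t.+1)%:R :> R by rewrite ltr0n expn_gt0 N0.
  rewrite mulrC -ler_pdivlMr // => hf; rewrite ler_pdivrMl //.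
  apply: le_trans hf _; rewrite le_eqVlt; apply/orP; left; apply/eqP.
  by field; rewrite !gt_eqF.
have feasib : (expect (fun s : t.+1.-tuple 'I_N => (enorm (resid P (ub s)))%:E)
    <= (N%:R / ((M - enorm ps) * eps * t.+1%:R))%:E * D5)%E.
  case: D5 {hD5} D5_ge0 real_case => [d| |] // _ real_case.
    by rewrite expect_fin -EFinM lee_fin; exact: (real_case d erefl).2.
  by rewrite gt0_muley ?lte_fin // leey.
split=> //; split.
(* For [ps = 0] the left side is 0 even if [D5] is infinite, and the claim is optimality of [us] for
   the objective itself. *)
- have [pz|pn0] := eqVneq (enorm ps) 0.
    rewrite pz !mul0r mul0e oppe0.
    rewrite -(expect_cst (t := t.+1) N0 0%E); apply: (expect_le N0) => s.
    have -> : (objF P us = lagr P us ps)%E.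
      by rewrite objF_fin // lagr_fin // (saddle_Lr PA saddle).
    have -> : (objF P (ub s) = lagr P (ub s) ps)%E.
      have /eqP : dot ps ps = 0 by rewrite -enorm_sqr pz expr0n.
      by rewrite dot_eq0 => /eqP ->; rewrite /lagr dot0l adde0.
    rewrite (lagr_fin _ dus) suber_ge0 // -(lagr_fin _ dus).
    exact: (saddle.2 _ _ (ubar_feas PA run t s)).2.
  have pp : 0 < enorm ps by rewrite lt_neqAle eq_sym pn0.
  case: D5 {hD5 feasib} D5_ge0 real_case => [d| |] // _ real_case; last first.
    by rewrite gt0_muley ?leNye // lte_fin divr_gt0 ?mulr_gt0.
  have [du0 hf] := real_case d erefl.
  have FE (s : t.+1.-tuple 'I_N) :
      (objF P (ub s) - objF P us)%E = (Fr P (ub s) - Fr P us)%:E.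
    by rewrite (objF_fin (ubar_domJ PA run du0 t s)) (objF_fin dus).
  rewrite (funext FE) expect_fin -EFinM -EFinN lee_fin.
  have hw : 0 <= (N ^ t.+1)%:R^-1 :> R by rewrite invr_ge0.
  have := ler_wpM2l ps0 hf; rewrite -lerN2 !mulrA => hl.
  apply: le_trans (_ : - (enorm ps * ((N ^ t.+1)%:R^-1 *
    \sum_(s : t.+1.-tuple 'I_N) enorm (resid P (ub s)))) <= _); first by rewrite !mulrA.
  rewrite mulrCA -mulrN ler_wpM2l // mulr_sumr -sumrN.
  by apply: ler_sum => s _; exact: primal_gap_ge PA run saddle t s du0.
(* With dual value 0, and zero residual at [us], the gap is the primal gap. *)
- have FE (s : t.+1.-tuple 'I_N) : (objF P (ub s) - objF P us
      = lagr P (ub s) 0 - lagr P us (pb s))%E.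
    rewrite (lagr_fin _ dus) (objF_fin dus) (saddle_Lr PA saddle).
    by rewrite /lagr dot0l adde0.
  rewrite (funext FE); apply: le_trans (fixed us 0 saddle.1) _.
  apply: lee_wpmul2l; last exact: hD5.
  by rewrite lee_fin divr_ge0 // mulr_ge0 // ltW.
Qed.
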